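(* Let $G=(V,E)$ be an infinite, connected graph of bounded degree (maximum degree $\Delta<\infty$) satisfying quadratic volume growth VG(2) and the Poincaré inequality PI. Fix $x_0\in V$ and let $G_n=B_{R_n}(x_0)$ be an exhaustion of $G$ by metric balls, with $N_n=|V(G_n)|\to\infty$. Assume the quantitative homogenisation hypothesis QH with heat-kernel constant $\mathcal{G}>0$ and exponent $\delta>0$. Then $$Z_n(1)=\mathcal{G}\,N_n\log N_n+O(N_n),$$ where the implicit constant depends only on the data of VG(2), PI, $\Delta$ and QH, and on a freely chosen parameter $\eta\in(0,1/2)$, but not on $n$. In particular the relative error is $O(1/\log N_n)$. Moreover, if $G$ and $G'$ are quasi-isometric graphs, each infinite, connected, of bounded degree, and satisfying VG(2), PI and QH, with the same constant $\mathcal{G}$ in QH for both graphs, then the statement transfers from $G$ to $G'$: for exhaustions of $G'$ by metric balls the same asymptotic $Z_n(1)=\mathcal{G}\,N_n\log N_n+O(N_n)$ holds (with $Z_n(1)$ and $N_n$ now defined from the exhausting balls of $G'$), with the same leading constant $\mathcal{G}$ and with an $O(N_n)$ remainder uniform in $n$.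
   Context: For a connected graph $G=(V,E)$, $d_G$ is the graph distance, $B_R(x)=\{y\in V: d_G(x,y)\le R\}$ the closed ball, and $V(x,R)=|B_R(x)|$ its number of vertices. $\log$ is the natural logarithm. VG(2): there exist $c_1,c_2>0$ such that $c_1R^2\le V(x,R)\le c_2R^2$ for all $x\in V$ and $R\ge 1$. PI: there exists $C_P>0$ such that for every ball $B_R=B_R(x)$ and every $f:V\to\mathbb{R}$, $\sum_{y\in B_R}(f(y)-\bar f_{B_R})^2\le C_PR^2\,\mathcal{E}_{B_{2R}}(f,f)$, where $\bar f_{B_R}$ is the average of $f$ over $B_R$ with respect to counting measure, $B_{2R}=B_{2R}(x)$, and $\mathcal{E}_U(f,f)=\sum_{\{y,z\}\in E,\ y,z\in U}(f(y)-f(z))^2$. Lazy simple random walk (LSRW): the discrete-time Markov chain $(X_t)_{t\ge0}$ on $V$ with transition matrix $P=\frac12(I+P_{SRW})$, where $P_{SRW}(x,y)=1/\deg(x)$ if $y\sim x$ and $0$ otherwise. Its heat kernel is $p_t(x,y)=\mathbb{P}_x[X_t=y]$. QH: there exist $\mathcal{G}>0$, $\delta>0$, $t_0\in\mathbb{N}$ and $C_{QH}<\infty$ such that for all $x\in V$ and all integers $t\ge t_0$, $\left|p_t(x,x)-\frac{\mathcal{G}}{t}\right|\le C_{QH}\,t^{-1-\delta}$. The data of QH are $(\mathcal{G},\delta,t_0,C_{QH})$. Dirichlet objects: for a finite vertex set $H\subset V$, $\mathcal{L}_H$ is the restriction to $H$ of $I-P$ (the matrix $(I-P)(x,y)$,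 $x,y\in H$), i.e. the generator of the LSRW killed upon exiting $H$. $Z_n(1)=\operatorname{tr}(\mathcal{L}_{G_n}^{-1})=\sum_k\lambda_k(G_n)^{-1}$, where $\lambda_k(G_n)$ are the eigenvalues of $\mathcal{L}_{G_n}$ with multiplicity. *)

(* Defs.v *)
From HB Require Import structures.
From mathcomp Require Import all_boot all_order all_algebra.
From mathcomp Require Import finmap.
From mathcomp Require Import all_classical all_reals all_analysis.

Set Implicit Arguments.
Unset Strict Implicit.
Unset Printing Implicit Defensive.

Import Order.TTheory GRing.Theory Num.Theory.
Import numFieldNormedType.Exports.

Local Open Scope classical_set_scope.
Local Open Scope ring_scope.

(* A simple graph with vertex type V is given by its adjacency relation. *)
Definition simple_graph (V : choiceType) (e : rel V) : Prop :=
  symmetric e /\ irreflexive e.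

Definition is_walk (V : choiceType) (e : rel V) (x y : V) (n : nat) : Prop :=
  exists p : seq V, [/\ path e x p, last x p = y & size p = n].

Definition graph_connected (V : choiceType) (e : rel V) : Prop :=
  forall x y : V, exists n : nat, is_walk e x y n.

Lemma ex_walk_asbool (V : choiceType) (e : rel V) (x y : V) :
  (exists n : nat, is_walk e x y n) -> exists n : nat, `[< is_walk e x y n >].
Proof. by case=> n xyn; exists n; apply/asboolP. Qed.

(* Junk value 0 when no walk joins x to y; used only for connected graphs. *)
Definition gdist (V : choiceType) (e : rel V) (x y : V) : nat :=
  match pselect (exists n : nat, is_walk e x y n) with
  | left xy => ex_minn (ex_walk_asbool xy)
  | right _ => 0%N
  end.

Definition nbhd (V : choiceType) (e : rel V) (x : V) : set V :=
  [set y | e x y].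

(* fset_set A is the finite set A when A is finite, and fset0 otherwise: the
   degree and the volume below are meaningful for locally finite graphs. *)
Definition deg (V : choiceType) (e : rel V) (x : V) : nat :=
  #|` fset_set (nbhd e x)|.

Definition bounded_degree (V : choiceType) (e : rel V) (Delta : nat) : Prop :=
  forall x : V, finite_set (nbhd e x) /\ (deg e x <= Delta)%N.

Definition gball (R : realType) (V : choiceType) (e : rel V) (x : V) (r : R) :
    set V :=
  [set y | (gdist e x y)%:R <= r].

Definition gballF (R : realType) (V : choiceType) (e : rel V) (x : V) (r : R) :
    {fset V} :=
  fset_set (gball e x r).

Definition vol (R : realType) (V : choiceType) (e : rel V) (x : V) (r : R) :
    nat :=
  #|` gballF e x r|.

Definition VG2 (R : realType) (V : choiceType) (e : rel V) (c1 c2 : R) : Prop :=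
  [/\ 0 < c1, 0 < c2 &
    forall (x : V) (r : R), 1 <= r ->
      c1 * r ^+ 2 <= (vol e x r)%:R <= c2 * r ^+ 2].

Definition average (R : realType) (V : choiceType) (B : {fset V}) (f : V -> R) :
    R :=
  (\sum_(y <- B) f y) / #|` B|%:R.

(* Every unordered edge {y, z} inside U occurs twice in the double sum. *)
Definition energy (R : realType) (V : choiceType) (e : rel V) (U : {fset V})
    (f : V -> R) : R :=
  2^-1 * \sum_(y <- U) \sum_(z <- U | e y z) (f y - f z) ^+ 2.

Definition poincare (R : realType) (V : choiceType) (e : rel V) (CP : R) :
    Prop :=
  0 < CP /\
  forall (x : V) (r : R) (f : V -> R), 0 <= r ->
    \sum_(y <- gballF e x r) (f y - average (gballF e x r) f) ^+ 2
      <= CP * r ^+ 2 * energy e (gballF e x (2 * r)) f.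

Definition srwP (R : realType) (V : choiceType) (e : rel V) (x y : V) : R :=
  if e x y then (deg e x)%:R^-1 else 0.

Definition lazyP (R : realType) (V : choiceType) (e : rel V) (x y : V) : R :=
  2^-1 * ((x == y)%:R + srwP R e x y).

(* P_x[X_t = y] for the Markov chain with transition matrix lazyP, i.e. the
   entry (x, y) of its t-th power. The sum is over all vertices z; it has
   finite support as soon as the graph is locally finite. *)
Fixpoint heat_kernel (R : realType) (V : choiceType) (e : rel V) (t : nat)
    (x y : V) : R :=
  if t is t'.+1 then
    \sum_(z \in [set: V]) lazyP R e x z * heat_kernel R e t' z y
  else (x == y)%:R.

(* The condition 0 < t only matters if t0 = 0: GG / t is undefined at t = 0. *)
Definition QH (R : realType) (V : choiceType) (e : rel V) (GG delta : R)
    (t0 : nat) (CQH : R) : Prop :=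
  [/\ 0 < GG, 0 < delta &
    forall (x : V) (t : nat), (0 < t)%N -> (t0 <= t)%N ->
      `| heat_kernel R e t x x - GG / t%:R | <= CQH * t%:R `^ (- 1 - delta)].

(* Restriction of I - P to H x H, with H enumerated by 'I_#|{: H}|. *)
Definition dirichlet_lap (R : realType) (V : choiceType) (e : rel V)
    (H : {fset V}) : 'M[R]_#|{: H}| :=
  \matrix_(i, j)
    let x := val (enum_val i) in let y := val (enum_val j) in
    (x == y)%:R - lazyP R e x y.

(* Z(1) for the domain H. For H finite in an infinite connected locally finite
   graph the killed walk dies out, so dirichlet_lap is invertible and invmx is
   its genuine inverse. *)
Definition Z1 (R : realType) (V : choiceType) (e : rel V) (H : {fset V}) : R :=
  \tr (invmx (dirichlet_lap R e H)).

Definition ball_exhaustion (R : realType) (V : choiceType) (e : rel V) (x0 : V)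
    (rad : nat -> R) : Prop :=
  [/\ forall n, 0 <= rad n,
      {homo (fun n => gball e x0 (rad n)) : m n / (m <= n)%N >-> m `<=` n},
      \bigcup_n gball e x0 (rad n) = [set: V] &
      vol e x0 (rad n) @[n --> \oo] --> \oo].

Definition quasi_isometric (R : realType) (V V' : choiceType) (e : rel V)
    (e' : rel V') (A B : R) : Prop :=
  [/\ 1 <= A, 0 <= B &
    exists phi : V -> V',
      (forall x y : V,
         A^-1 * (gdist e x y)%:R - B <= (gdist e' (phi x) (phi y))%:R
           <= A * (gdist e x y)%:R + B) /\
      (forall y' : V', exists x : V, (gdist e' (phi x) y')%:R <= B)].

Definition graph_hyp (R : realType) (V : choiceType) (e : rel V) (Delta : nat)
    (c1 c2 CP GG delta : R) (t0 : nat) (CQH : R) : Prop :=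
  [/\ simple_graph e, infinite_set [set: V] & graph_connected e] /\
  [/\ bounded_degree e Delta, VG2 e c1 c2, poincare e CP &
      QH e GG delta t0 CQH].

(* Second clause: relative error. It is stated for N > 1, where ln N > 0. *)
Definition trace_asymptotics (R : realType) (V : choiceType) (e : rel V)
    (x0 : V) (rad : nat -> R) (GG C : R) : Prop :=
  forall n : nat,
    let N : R := (vol e x0 (rad n))%:R in
    let Z : R := Z1 R e (gballF e x0 (rad n)) in
    `| Z - GG * N * ln N | <= C * N /\
    (1 < N -> `| Z / (GG * N * ln N) - 1 | <= C / ln N).

(* Main.v *)
Require Import Defs.
From HB Require Import structures.
From mathcomp Require Import all_boot all_order all_algebra.
From mathcomp Require Import finmap.
From mathcomp Require Import all_classical all_reals all_analysis.
From mathcomp Require Import ring lra zify.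
Import Order.TTheory GRing.Theory Num.Theory.
Import numFieldNormedType.Exports.
Set Implicit Arguments.
Unset Strict Implicit.
Unset Printing Implicit Defensive.
Local Open Scope classical_set_scope.
Local Open Scope ring_scope.

(** Let H be the ball of natural radius r about x0, N its cardinality, and
let K_t be the heat kernel of the walk killed outside H.  The trace Z is the
sum over x in H of the Green function sum_t K_t(x,x), so the theorem says that
on average over H the Green function on the diagonal is
GG ln N + O(1) = 2 GG ln (r+1) + O(1).

Truncation.  The Poincare inequality on a concentric ball of at least twice the volume gives a
Dirichlet spectral gap of order (r+1)^-2 (spectral_gap).  Writing the inverse
Laplacian X as sum_(t < 2k) K_t + K_k X K_k, the gap bounds the trace of the
last term by (r+1)^2 times the trace of K_2k, up to a constant
(Z1_truncation).  With k = (r+1)^2 and the on-diagonal bound K_2k(x,x) = O(1/k)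
this is O(N).

Upper bound.  Before the truncation time, K_t is at most the heat kernel p_t
of the whole graph, and the homogenisation hypothesis together with the
harmonic sum gives sum_(t < T) p_t(x,x) = GG ln T + O(1)
(sum_heat_kernel_ondiag).

Lower bound.  Let rho be the depth of x in H, so that the walk started at x
needs rho steps to leave H.  Up to time rho^2 the killed Green function at x
differs from the free one by at most the largest truncated Green function
between x and a point outside H (killing_comparison).  That quantity is O(1),
because p_t(z,x) = O(d(x,z)^-2) uniformly in t (kkernel_offdiag): the fourth
moment sum_y deg(y) d(x,y)^4 p_t(y,x)^2 grows at most linearly in t, by an
energy inequality closed up by the on-diagonal bound, and p_2t(z,x) is
controlled by these moments at x and z.  No Gaussian estimate is used.
Hence the Green function at x is at least 2 GG ln rho - O(1).

Boundary layer.  It remains that the sum over H of ln ((r+1) / rho) is O(N)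
(sum_log_depth).  Moving a point of depth at most s inwards along a geodesic
shows that the points of depth in (s, 3s] make up a fixed proportion of those
of depth at most 3s; summing this against 1/s gives the claim.

The same constant serves every graph with the given data, and the second half
of the theorem is the first half applied to the second graph. *)

(** * Graph distance and balls *)

Section Metric.
Variables (V : choiceType) (e : rel V).

Lemma gdist_min (x y : V) n : is_walk e x y n -> (gdist e x y <= n)%N.
Proof.
move=> w; rewrite /gdist; case: pselect => [h|]; last by [].
by case: ex_minnP => k _; apply; apply/asboolP.
Qed.

Lemma gdist_xx (x : V) : gdist e x x = 0%N.
Proof. by apply/eqP; rewrite -leqn0; apply: gdist_min; exists [::]. Qed.

Hypotheses (esym : symmetric e) (econ : graph_connected e).

Lemma gdist_walk (x y : V) : is_walk e x y (gdist e x y).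
Proof.
rewrite /gdist; case: pselect => [h|]; last by move/(_ (econ x y)).
by case: ex_minnP => k /asboolP.
Qed.

Lemma gdist_eq0 (x y : V) : (gdist e x y == 0%N) = (x == y).
Proof.
apply/eqP/eqP => [d0|->]; last exact: gdist_xx.
have [p [_ lp]] := gdist_walk x y; rewrite d0 => /size0nil p0.
by rewrite -lp p0.
Qed.

Lemma gdist_triangle (y x z : V) :
  (gdist e x z <= gdist e x y + gdist e y z)%N.
Proof.
have [p [pp lp sp]] := gdist_walk x y; have [q [pq lq sq]] := gdist_walk y z.
apply: gdist_min; exists (p ++ q).
by rewrite cat_path pp lp pq last_cat lp lq size_cat sp sq.
Qed.

Lemma gdist_sym (x y : V) : gdist e x y = gdist e y x.
Proof.
wlog suff h : x y / (gdist e x y <= gdist e y x)%N.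
  by apply/eqP; rewrite eqn_leq !h.
have [p [pp lp sp]] := gdist_walk y x.
apply: gdist_min; exists (rev (belast y p)); split.
- rewrite -lp rev_path -(eq_path (e := e)) // => u v; exact: esym.
- by case: p {pp sp} lp => [/= ->//|z p _]; rewrite /= rev_cons last_rcons.
- by rewrite size_rev size_belast.
Qed.

Lemma gdist_adj (x y z : V) : e y z -> (gdist e x z <= (gdist e x y).+1)%N.
Proof.
move=> yz; apply: leq_trans (gdist_triangle y x z) _.
by rewrite -addn1 leq_add2l; apply: gdist_min; exists [:: z]; rewrite /= yz.
Qed.

Lemma geodesic_point (x y : V) k : (k <= gdist e x y)%N ->
  exists z, gdist e x z = k /\ (gdist e z y <= gdist e x y - k)%N.
Proof.
move=> kd; have [p [pp lp sp]] := gdist_walk x y.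
pose z := last x (take k p); exists z.
have /andP[p1 p2] : path e x (take k p) && path e z (drop k p).
  by rewrite -cat_path cat_take_drop.
have zy : last z (drop k p) = y by rewrite -last_cat cat_take_drop.
have d1 : (gdist e x z <= k)%N.
  by apply: gdist_min; exists (take k p); rewrite size_takel // sp.
have d2 : (gdist e z y <= gdist e x y - k)%N.
  by apply: gdist_min; exists (drop k p); rewrite size_drop sp.
split=> //; have := gdist_triangle z x y; lia.
Qed.

(** Balls of natural radius are independent of the real field, unlike gballF;
gballF_nball reduces every real radius to one of these. *)
Definition nball (x : V) (n : nat) : {fset V} :=
  fset_set [set y | (gdist e x y <= n)%N].

Hypothesis efin : forall x, finite_set (nbhd e x).

(** A ball of radius n+1 is covered by the ball of radius n and the
neighbourhoods of its points, since the last but one vertex of a geodesic lies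
in the smaller ball. *)
Lemma finite_nball (x : V) n : finite_set [set y | (gdist e x y <= n)%N].
Proof.
elim: n => [|n ih].
  apply: (sub_finite_set (B := [set x])) => // y /=.
  by rewrite leqn0 gdist_eq0 => /eqP.
apply: (sub_finite_set (B := [set y | (gdist e x y <= n)%N] `|`
   \bigcup_(z in [set y | (gdist e x y <= n)%N]) nbhd e z)); last first.
  by rewrite finite_setU; split => //; apply: bigcup_finite.
move=> y /=; rewrite leq_eqVlt => /orP[/eqP dy|]; last by left.
right; have [|z [dz zy]] := @geodesic_point x y n; first by rewrite dy.
exists z; first by rewrite /= dz.
move: zy; rewrite dy subSnn => zy.
have [p [pp lp sp]] := gdist_walk z y.
case: p pp lp sp => [_ /= zy' _|w [|? ?] /=]; last 2 first.
- by rewrite andbT => zw <-.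
- by move=> _ _ h; rewrite -h in zy.
by move: dy; rewrite -zy' dz => /eqP; rewrite -[X in X == _]addn0 -addn1 eqn_add2l.
Qed.

Lemma in_nball (x y : V) n : (y \in nball x n) = (gdist e x y <= n)%N.
Proof.
rewrite /nball in_fset_set; last exact: finite_nball.
by apply/idP/idP; rewrite inE.
Qed.

Lemma gballF_nball (R : realType) (x : V) (r : R) : 0 <= r ->
  gballF e x r = nball x (Num.truncn r).
Proof.
move=> r0; rewrite /gballF /nball; congr fset_set.
apply/seteqP; split => y; rewrite /gball /=; by rewrite truncn_ge_nat.
Qed.

End Metric.

(** * Sums over finite sets *)

Section FsetSums.
Variables (R : realDomainType) (V : choiceType).
Implicit Types (F H : {fset V}) (f g : V -> R).

Lemma fsum_le F f g : (forall y, y \in F -> f y <= g y) ->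
  \sum_(y <- F) f y <= \sum_(y <- F) g y.
Proof. by move=> h; rewrite big_seq [leRHS]big_seq; apply: ler_sum. Qed.

Lemma fsum_ge0 F f : (forall y, y \in F -> 0 <= f y) -> 0 <= \sum_(y <- F) f y.
Proof. by move=> h; rewrite big_seq; apply: sumr_ge0. Qed.

Lemma fsum_eq F f g : (forall y, y \in F -> f y = g y) ->
  \sum_(y <- F) f y = \sum_(y <- F) g y.
Proof. by move=> h; apply: eq_big_seq. Qed.

Lemma fsum_subset F H f : (H `<=` F)%fset -> (forall y, y \in F -> 0 <= f y) ->
  \sum_(y <- H) f y <= \sum_(y <- F) f y.
Proof.
move=> HF f0; rewrite (big_fsetID _ (mem H) F) /=.
rewrite [X in _ <= X + _](_ : _ = \sum_(y <- H) f y); last first.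
  by apply: eq_fbigl => y; rewrite !inE /= andb_idl // => yH; apply: (fsubsetP HF).
by rewrite lerDl; apply: fsum_ge0 => y; rewrite !inE => /andP[/f0].
Qed.

Lemma fsum_delta F (x : V) f : x \in F ->
  \sum_(y <- F) (x == y)%:R * f y = f x.
Proof.
move=> xF; rewrite (big_fsetD1 x xF) /= eqxx mul1r big1_fset ?addr0 // => y.
by rewrite !inE eq_sym => /andP[/negPf-> _] _; rewrite mul0r.
Qed.

Lemma fsum_const F (c : R) : \sum_(y <- F) c = #|` F|%:R * c.
Proof. by rewrite big_const_seq count_predT iter_addr_0 mulr_natl. Qed.

End FsetSums.

(** * The killed walk *)

Definition wdeg (R : realType) (V : choiceType) (e : rel V) (y : V) : R :=
  (deg e y)%:R.

Definition wadj (R : realType) (V : choiceType) (e : rel V) (y z : V) : R :=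
  (e y z)%:R.

Section Kernel.
Variables (R : realType) (V : choiceType) (e : rel V).
Hypotheses (esym : symmetric e) (eirr : irreflexive e).
Hypothesis efin : forall x, finite_set (nbhd e x).
Hypothesis deg_gt0 : forall x, (0 < deg e x)%N.
Implicit Types (F H : {fset V}) (x y z : V).

Local Notation P := (lazyP R e).
Local Notation a := (wadj R e).
Local Notation m := (wdeg R e).

Lemma wdeg_gt0 y : 0 < m y. Proof. by rewrite ltr0n. Qed.
Let m_gt0 := wdeg_gt0.
Let m_ge0 y : 0 <= m y := ltW (m_gt0 y).
Let m_neq0 y : m y != 0 := lt0r_neq0 (m_gt0 y).

Lemma wadj_ge0 y z : 0 <= a y z. Proof. exact: ler0n. Qed.
Hint Resolve wadj_ge0 : core.

Lemma wadjC y z : a y z = a z y. Proof. by rewrite /a esym. Qed.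

Lemma lazyPE y z : P y z = 2^-1 * ((y == z)%:R + a y z / m y).
Proof. by rewrite /lazyP /srwP /wadj; case: (e y z); rewrite ?mul1r ?mul0r. Qed.

Lemma lazyP_ge0 y z : 0 <= P y z.
Proof. by rewrite lazyPE mulr_ge0 ?invr_ge0 ?addr_ge0 ?ler0n ?divr_ge0. Qed.

Lemma lazyP_rev y z : m y * P y z = m z * P z y.
Proof.
rewrite !lazyPE (eq_sym z y) (wadjC z y).
have [->//|_] := eqVneq y z.
have key w t : m w * (2^-1 * (false%:R + t / m w)) = 2^-1 * t.
  by rewrite add0r mulrCA mulrC mulrCA divff ?mulr1 // mulrC.
by rewrite !key.
Qed.

Definition nbhdF (y : V) : {fset V} := fset_set (nbhd e y).

Lemma in_nbhdF y z : (z \in nbhdF y) = e y z.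
Proof. by rewrite /nbhdF in_fset_set //; apply/idP/idP; rewrite inE. Qed.

Lemma sum_adj_sup F y : (nbhdF y `<=` F)%fset -> \sum_(z <- F) a y z = m y.
Proof.
move=> sF; rewrite -(big_fset_incl _ sF); last first.
  by move=> z _; rewrite in_nbhdF /wadj => /negPf->.
rewrite (fsum_eq (g := fun=> 1)); last by move=> z; rewrite in_nbhdF /wadj => ->.
by rewrite fsum_const mulr1.
Qed.

Lemma sum_adj_le F y : \sum_(z <- F) a y z <= m y.
Proof.
rewrite -(@sum_adj_sup (nbhdF y `|` F)%fset) ?fsubsetUl //.
by apply: fsum_subset; rewrite ?fsubsetUr // => z _; rewrite /wadj.
Qed.

Lemma sum_lazyP F y (f : V -> R) : y \in F ->
  \sum_(z <- F) P y z * f z = 2^-1 * (f y + (\sum_(z <- F) a y z * f z) / m y).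
Proof.
move=> yF; rewrite -(fsum_delta f yF) mulr_suml -big_split mulr_sumr /=.
by apply: fsum_eq => z _; rewrite lazyPE; ring.
Qed.

Lemma sum_lazyP_le1 F y : \sum_(z <- F) P y z <= 1.
Proof.
have yF : y \in (y |` F)%fset by rewrite !inE eqxx.
have : \sum_(z <- (y |` F)%fset) P y z * 1 <= 1.
  rewrite sum_lazyP // -[leRHS](mulVf (x := 2)) ?pnatr_eq0 //.
  rewrite ler_wpM2l ?invr_ge0 // -[leRHS]/(1 + 1) lerD2l.
  rewrite ler_pdivrMr ?m_gt0 // mul1r -mulr_suml mulr1; exact: sum_adj_le.
apply: le_trans; under [leRHS]eq_bigr do rewrite mulr1.
by apply: fsum_subset; rewrite ?fsubsetU1 // => z _; apply: lazyP_ge0.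
Qed.

Lemma heat_kernelS F t x y : (x |` nbhdF x `<=` F)%fset ->
  heat_kernel R e t.+1 x y = \sum_(z <- F) P x z * heat_kernel R e t z y.
Proof.
move=> sF /=; apply: fsbigTE => z zF; have : z \notin (x |` nbhdF x)%fset.
  by apply: contra zF; apply: (fsubsetP sF).
rewrite !inE in_nbhdF negb_or eq_sym lazyPE /wadj => /andP[/negPf-> /negPf->].
by rewrite mul0r addr0 mulr0 mul0r.
Qed.

Lemma heat_kernel_ge0 t x y : 0 <= heat_kernel R e t x y.
Proof.
elim: t x => [|t ih] x; first by rewrite /= ler0n.
rewrite (heat_kernelS (F := (x |` nbhdF x)%fset)) //.
by apply: fsum_ge0 => z _; rewrite mulr_ge0 ?lazyP_ge0.
Qed.

Lemma heat_kernel_le1 t x y : heat_kernel R e t x y <= 1.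
Proof.
elim: t x => [|t ih] x; first by rewrite /= lern1 leq_b1.
rewrite (heat_kernelS (F := (x |` nbhdF x)%fset)) //.
apply: le_trans (sum_lazyP_le1 (x |` nbhdF x)%fset x); apply: fsum_le => z _.
by rewrite -[leRHS]mulr1 ler_wpM2l ?lazyP_ge0.
Qed.

(** The heat kernel of the walk killed on leaving F.  For large F it is the heat
kernel of the whole graph up to a given time, so that every estimate can be
made on finite sums. *)
Fixpoint kkernel F (t : nat) (x y : V) : R :=
  if t is t'.+1 then \sum_(z <- F) P x z * kkernel F t' z y else (x == y)%:R.

Lemma kkernel_ge0 F t x y : 0 <= kkernel F t x y.
Proof.
elim: t x => [|t ih] x /=; first by rewrite ler0n.
by apply: fsum_ge0 => z _; rewrite mulr_ge0 ?lazyP_ge0.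
Qed.

Lemma kkernel_le_heat F t x y : kkernel F t x y <= heat_kernel R e t x y.
Proof.
elim: t x => [//|t ih] x.
rewrite (heat_kernelS (F := ((x |` nbhdF x) `|` F)%fset)) ?fsubsetUl // [leLHS]/=.
apply: (@le_trans _ _ (\sum_(z <- F) P x z * heat_kernel R e t z y)).
  by apply: fsum_le => z _; rewrite ler_wpM2l ?lazyP_ge0.
apply: fsum_subset; first exact: fsubsetUr.
by move=> z _; rewrite mulr_ge0 ?lazyP_ge0 ?heat_kernel_ge0.
Qed.

Lemma kkernelD F s t x y : x \in F ->
  kkernel F (s + t) x y = \sum_(z <- F) kkernel F s x z * kkernel F t z y.
Proof.
elim: s x => [|s ih] x xF; first by rewrite /= (fsum_delta (fun z => kkernel F t z y)).
rewrite addSn /=.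
under [RHS]eq_bigr do rewrite mulr_suml.
rewrite exchange_big /=; apply: fsum_eq => z zF; rewrite ih // mulr_sumr.
by apply: eq_bigr => w _; rewrite mulrA.
Qed.

Lemma kkernel_rev F t x y : x \in F -> y \in F ->
  m x * kkernel F t x y = m y * kkernel F t y x.
Proof.
elim: t x y => [|t ih] x y xF yF.
  by rewrite /= (eq_sym y); case: eqVneq => [->|]; rewrite ?mulr0.
rewrite -[in RHS]addn1 kkernelD // /= !mulr_sumr; apply: fsum_eq => z zF.
rewrite (eq_bigr (fun w => (x == w)%:R * P z w)); last first.
  by move=> w _; rewrite mulrC eq_sym.
by rewrite fsum_delta // mulrA lazyP_rev mulrAC ih // mulrA.
Qed.

(** The walk stays put with probability 1/2, so estimates at even times pass to
odd times. *)
Lemma kkernel_lazy F t x y : x \in F ->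
  kkernel F t x y <= 2 * kkernel F t.+1 x y.
Proof.
move=> xF /=; rewrite (big_fsetD1 x xF) /= mulrDr.
apply: (@le_trans _ _ (2 * (P x x * kkernel F t x y))).
  rewrite lazyPE eqxx /wadj eirr mul0r addr0 mulr1 mulrA divff ?pnatr_eq0 // mul1r //.
rewrite lerDl mulr_ge0 //; apply: fsum_ge0 => z _.
by rewrite mulr_ge0 ?lazyP_ge0 ?kkernel_ge0.
Qed.

Definition dirichlet_form F (f : V -> R) : R :=
  \sum_(y <- F) m y * f y * (f y - \sum_(z <- F) P y z * f z).

Section Weighted.
Variables (F : {fset V}) (u q : V -> R).

(** Write one step as u + v, where v is half the average increment of u along
the edges.  The square of v is bounded by the averaged squared increments
(Cauchy-Schwarz, obtained as positivity of a variance); the mass lost outside F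
only helps. *)
Lemma lazy_step_square_le y : y \in F ->
  m y * (\sum_(z <- F) P y z * u z) ^+ 2 <=
    m y * u y ^+ 2 + \sum_(z <- F) a y z *
       (4^-1 * (u y - u z) ^+ 2 - u y * (u y - u z)).
Proof.
move=> yF; rewrite sum_lazyP //.
set s := \sum_(z <- F) a y z; have sm : s <= m y by exact: sum_adj_le.
set B := \sum_(z <- F) a y z * u z.
pose A := \sum_(z <- F) a y z * u z ^+ 2.
have -> : \sum_(z <- F) a y z * (4^-1 * (u y - u z) ^+ 2 - u y * (u y - u z)) =
   4^-1 * (s * u y ^+ 2 - 2 * u y * B + A) - u y * (s * u y - B).
  rewrite /s /B /A mulr_suml !mulr_sumr -sumrB -big_split /= mulr_sumr.
  by rewrite mulr_suml -sumrB mulr_sumr -sumrB; apply: eq_bigr => z _; ring.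
have var c : 0 <= A - 2 * c * B + c ^+ 2 * s.
  rewrite /A /B /s !mulr_sumr -sumrB -big_split /=; apply: fsum_ge0 => z _.
  rewrite (_ : _ + _ = a y z * (u z - c) ^+ 2); last by ring.
  by rewrite mulr_ge0 ?sqr_ge0 // /wadj.
have m0 := m_gt0 y; have := var (B / m y); set b := B / m y.
have -> : B = m y * b by rewrite /b mulrC divfK.
move=> h; have hb : 0 <= (m y - s) * b ^+ 2 by rewrite mulr_ge0 ?sqr_ge0 ?subr_ge0.
have hu : 0 <= (m y - s) * u y ^+ 2 by rewrite mulr_ge0 ?sqr_ge0 ?subr_ge0.
nra.
Qed.

(** A discrete Caccioppoli inequality for the weight q^2: one step of the walk
increases the weighted norm by at most the norm of u weighted by the squared
gradient of q.  After symmetrising the sum over edges, laziness leaves a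
negative multiple of q^2 times the squared gradient of u, which absorbs the
cross term. *)
Lemma weighted_energy_step :
  \sum_(y <- F) m y * q y ^+ 2 * (\sum_(z <- F) P y z * u z) ^+ 2 <=
  \sum_(y <- F) m y * q y ^+ 2 * u y ^+ 2 +
  \sum_(y <- F) \sum_(z <- F) a y z * (q y - q z) ^+ 2 * u y ^+ 2.
Proof.
pose g y z := q y ^+ 2 * (4^-1 * (u y - u z) ^+ 2 - u y * (u y - u z)).
apply: (@le_trans _ _ (\sum_(y <- F) m y * q y ^+ 2 * u y ^+ 2 +
  \sum_(y <- F) \sum_(z <- F) a y z * g y z)).
  rewrite -big_split /=; apply: fsum_le => y yF.
  rewrite mulrAC (mulrC (m y * _)) [leRHS](_ : _ = q y ^+ 2 *
   (m y * u y ^+ 2 + \sum_(z <- F) a y z *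
       (4^-1 * (u y - u z) ^+ 2 - u y * (u y - u z)))); last first.
    rewrite mulrDr mulr_sumr; congr (_ + _); first by ring.
    by apply: eq_bigr => z _; rewrite /g; ring.
  by rewrite ler_wpM2l ?sqr_ge0 // lazy_step_square_le.
rewrite lerD2l.
have swap (f : V -> V -> R) : \sum_(y <- F) \sum_(z <- F) f y z =
   2^-1 * \sum_(y <- F) \sum_(z <- F) (f y z + f z y).
  under [in RHS]eq_bigr do rewrite big_split.
  rewrite big_split /= [X in _ + X]exchange_big /= -mulr2n -[X in _ * X]mulr_natl.
  by rewrite mulrA mulVf ?mul1r ?pnatr_eq0.
rewrite swap [leRHS]swap ler_wpM2l ?invr_ge0 //.
apply: fsum_le => y _; apply: fsum_le => z _.
rewrite (wadjC z y) -!mulrA -!mulrDr ler_wpM2l // /g.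
(* The negative gradient term and the cross term complete the first square. *)
have := sqr_ge0 ((q y + q z) * (u y - u z) + 2 * (q y - q z) * (u y + u z)).
have := sqr_ge0 ((q y - q z) * (u y - u z)).
nra.
Qed.

End Weighted.

End Kernel.

(** * Off-diagonal decay and comparison of killed walks *)

Section OffDiagonal.
Variables (R : realType) (V : choiceType) (e : rel V).
Hypotheses (esym : symmetric e) (eirr : irreflexive e).
Hypothesis econ : graph_connected e.
Hypothesis efin : forall x, finite_set (nbhd e x).
Hypothesis deg_gt0 : forall x, (0 < deg e x)%N.
Implicit Types (F H : {fset V}) (x y z : V).

Local Notation P := (lazyP R e).
Local Notation a := (wadj R e).
Local Notation m := (wdeg R e).

Variables (Delta : nat) (Kd : R).
Hypothesis deg_le : forall x, (deg e x <= Delta)%N.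
Hypothesis Kd_ge0 : 0 <= Kd.
Hypothesis ondiag : forall x t, heat_kernel R e (t + t) x x <= Kd / t.+1%:R.

Let B : R := Delta%:R * Kd.
Let B_ge0 : 0 <= B. Proof. by rewrite mulr_ge0. Qed.
Let m_ge0 y : 0 <= m y. Proof. exact: ler0n. Qed.
Let d x y : R := (gdist e x y)%:R.
Let d_ge0 x y : 0 <= d x y. Proof. exact: ler0n. Qed.

Lemma kernel_l2_le F x t : x \in F ->
  \sum_(y <- F) m y * kkernel R e F t y x ^+ 2 <= B / t.+1%:R.
Proof.
move=> xF.
have -> : \sum_(y <- F) m y * kkernel R e F t y x ^+ 2 =
    m x * kkernel R e F (t + t) x x.
  rewrite kkernelD // mulr_sumr; apply: fsum_eq => y yF.
  by rewrite mulrA kkernel_rev // expr2 mulrA.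
rewrite /B -mulrA ler_pM ?kkernel_ge0 ?ler_nat //.
exact: le_trans (kkernel_le_heat R efin deg_gt0 F (t + t) x x) (ondiag x t).
Qed.

(** Apply the energy inequality with q = d(x,.)^2, whose squared gradient is at
most 8 d^2 + 2.  The second moment that appears is split by the
arithmetic-geometric mean inequality, with weight of order 1/t, into the fourth
moment, which is O(t) by induction, and the squared norm, which is O(1/t) by the
on-diagonal bound; so the increment is O(1). *)
Lemma kernel_fourth_moment_le F x t : x \in F ->
  \sum_(y <- F) m y * (d x y ^+ 2) ^+ 2 * kkernel R e F t y x ^+ 2
    <= 100 * B * t.+1%:R.
Proof.
move=> xF; elim: t => [|t ih].
  rewrite big1_fset; first by rewrite !mulr_ge0.
  move=> y _ _ /=; have [->|] := eqVneq y x; last by rewrite expr0n mulr0.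
  by rewrite /d gdist_xx !expr0n /= mulr0 mul0r.
pose u y := kkernel R e F t y x.
apply: le_trans (weighted_energy_step esym efin deg_gt0 F u (fun y => d x y ^+ 2)) _.
have T0 : (0 : R) < t.+1%:R by rewrite ltr0n.
(* The factor 10 makes the increment 40 B + 40 B + 2 B, below 100 B. *)
pose c : R := 10 * t.+1%:R.
have c0 : 0 < c by rewrite mulr_gt0.
have grad y : y \in F ->
    \sum_(z <- F) a y z * (d x y ^+ 2 - d x z ^+ 2) ^+ 2 * u y ^+ 2 <=
    4 / c * (m y * (d x y ^+ 2) ^+ 2 * u y ^+ 2) +
    (4 * c + 2) * (m y * u y ^+ 2).
  move=> yF.
  apply: (@le_trans _ _ (\sum_(z <- F) a y z * ((8 * d x y ^+ 2 + 2) * u y ^+ 2))).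
    apply: fsum_le => z _; rewrite -mulrA /wadj.
    have [yz|_] := boolP (e y z); last by rewrite !mul0r.
    rewrite !mul1r ler_wpM2r ?sqr_ge0 //.
    have h1 : d x z <= d x y + 1 by rewrite /d natr1 ler_nat gdist_adj.
    have h2 : d x y <= d x z + 1 by rewrite /d natr1 ler_nat gdist_adj // esym.
    have := d_ge0 x y; have := d_ge0 x z.
    move: (d x y) (d x z) h1 h2 => p q h1 h2 q0 p0.
    have -> : (p ^+ 2 - q ^+ 2) ^+ 2 = (p - q) ^+ 2 * (p + q) ^+ 2 by ring.
    have g1 : (p - q) ^+ 2 <= 1 by nra.
    have g2 : (p + q) ^+ 2 <= 8 * p ^+ 2 + 2 by have := sqr_ge0 (2 * p - 1); nra.
    rewrite -[leRHS]mul1r ler_pM ?sqr_ge0 //.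
  rewrite -mulr_suml.
  apply: (@le_trans _ _ (m y * ((8 * d x y ^+ 2 + 2) * u y ^+ 2))).
    rewrite ler_wpM2r ?(sum_adj_le R efin) // mulr_ge0 ?sqr_ge0 //.
    by rewrite addr_ge0 ?mulr_ge0 ?sqr_ge0.
  rewrite [leRHS](_ : _ = m y * ((4 / c * (d x y ^+ 2) ^+ 2 + 4 * c + 2) * u y ^+ 2));
    last by ring.
  rewrite ler_wpM2l // ler_wpM2r ?sqr_ge0 // lerD2r.
  move: (d x y ^+ 2) => p.
  have -> : 4 / c * p ^+ 2 + 4 * c = 4 * c * (p / c - 1) ^+ 2 + 8 * p.
    by field; rewrite gt_eqF.
  by rewrite lerDr mulr_ge0 ?sqr_ge0 // mulr_ge0 // ltW.
have m2 := kernel_l2_le t xF; rewrite -/u in m2.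
apply: (@le_trans _ _ (100 * B * t.+1%:R +
    (4 / c * (100 * B * t.+1%:R) + (4 * c + 2) * (B / t.+1%:R)))).
  apply: lerD => //.
  apply: le_trans (fsum_le grad) _; rewrite big_split /= -!mulr_sumr lerD //.
    by rewrite ler_wpM2l // divr_ge0 // ltW.
  by rewrite ler_wpM2l // addr_ge0 // mulr_ge0 // ltW.
have -> : 4 / c * (100 * B * t.+1%:R) = 40 * B.
  by rewrite /c; field; rewrite ?gt_eqF.
have -> : (4 * c + 2) * (B / t.+1%:R) = 40 * B + 2 * (B / t.+1%:R).
  by rewrite /c; field; rewrite ?gt_eqF.
have : B / t.+1%:R <= B by rewrite ler_pdivrMr // ler_peMr // ler1n.
rewrite -[t.+2%:R]natr1; have := B_ge0.
by move: (B / _) => b; move: B => b0; move: t.+1%:R => T; nra.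
Qed.

(** Chapman-Kolmogorov at the midpoint: an intermediate point y is far from x or
from z, as d(x,z)^2 <= 2 (d(x,y)^2 + d(y,z)^2).  Each half is bounded by the
geometric mean of a fourth moment O(t) and a squared norm O(1/t), hence by a
constant that does not depend on t. *)
Lemma kkernel_offdiag_even F x z t : x \in F -> z \in F ->
  d x z ^+ 2 * kkernel R e F (t + t) z x <= 202 * B.
Proof.
move=> xF zF; have T0 : (0 : R) < t.+1%:R by rewrite ltr0n.
have mz1 : 1 <= m z by rewrite ler1n.
have K0 : 0 <= d x z ^+ 2 * kkernel R e F (t + t) z x.
  by rewrite mulr_ge0 ?sqr_ge0 // kkernel_ge0.
apply: (@le_trans _ _ (m z * (d x z ^+ 2 * kkernel R e F (t + t) z x))).
  by rewrite ler_peMl.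
rewrite kkernelD // mulrA !mulr_sumr.
pose ux y := kkernel R e F t y x; pose uz y := kkernel R e F t y z.
set T := t.+1%:R in T0 *.
(* The two terms of the arithmetic-geometric mean inequality for d^2 u v. *)
pose h (u v : V -> R) w y :=
  T^-1 * (m y * (d w y ^+ 2) ^+ 2 * u y ^+ 2) + T * (m y * v y ^+ 2).
have hsum u v w : \sum_(y <- F) m y * (d w y ^+ 2) ^+ 2 * u y ^+ 2 <= 100 * B * T ->
    \sum_(y <- F) m y * v y ^+ 2 <= B / T -> \sum_(y <- F) h u v w y <= 101 * B.
  move=> h1 h2; rewrite /h big_split /= -!mulr_sumr.
  apply: (@le_trans _ _ (T^-1 * (100 * B * T) + T * (B / T))).
    by rewrite lerD // ler_wpM2l // ?invr_ge0 ltW.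
  rewrite le_eqVlt; apply/orP; left; apply/eqP; field; exact: lt0r_neq0.
apply: (@le_trans _ _ (\sum_(y <- F) (h ux uz x y + h uz ux z y))); last first.
  rewrite big_split /=.
  have := hsum ux uz x (kernel_fourth_moment_le t xF) (kernel_l2_le t zF).
  have := hsum uz ux z (kernel_fourth_moment_le t zF) (kernel_l2_le t xF).
  lra.
apply: fsum_le => y yF.
rewrite [leLHS](_ : _ = m z * kkernel R e F t z y * (d x z ^+ 2 * ux y)); last first.
  by rewrite /ux; ring.
rewrite (kkernel_rev R esym deg_gt0) // -/(uz y) /h.
have dxz : d x z <= d x y + d z y.
  by rewrite /d -natrD ler_nat (gdist_sym esym econ z y); exact: gdist_triangle.
have d2 : d x z ^+ 2 <= 2 * (d x y ^+ 2 + d z y ^+ 2).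
  have : d x z ^+ 2 <= (d x y + d z y) ^+ 2.
    by rewrite ler_pXn2r // nnegrE ?addr_ge0 ?d_ge0.
  have := sqr_ge0 (d x y - d z y); nra.
have ux0 : 0 <= ux y by rewrite kkernel_ge0.
have uz0 : 0 <= uz y by rewrite kkernel_ge0.
have amgm p u v : 2 * p * u * v <= T^-1 * (p ^+ 2 * u ^+ 2) + T * v ^+ 2.
  rewrite -subr_ge0 [leRHS](_ : _ = T^-1 * (p * u - T * v) ^+ 2).
    by rewrite mulr_ge0 ?sqr_ge0 // invr_ge0 ltW.
  by field; rewrite gt_eqF.
apply: (@le_trans _ _ (m y * (2 * d x y ^+ 2 * ux y * uz y + 2 * d z y ^+ 2 * uz y * ux y))).
  rewrite -mulrA ler_wpM2l //.
  have := ler_wpM2r (mulr_ge0 ux0 uz0) d2; nra.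
apply: (@le_trans _ _ (m y * (T^-1 * ((d x y ^+ 2) ^+ 2 * ux y ^+ 2) + T * uz y ^+ 2 +
   (T^-1 * ((d z y ^+ 2) ^+ 2 * uz y ^+ 2) + T * ux y ^+ 2)))).
  by rewrite ler_wpM2l // lerD.
by rewrite le_eqVlt; apply/orP; left; apply/eqP; ring.
Qed.

Lemma kkernel_offdiag F x z t : x \in F -> z \in F ->
  d x z ^+ 2 * kkernel R e F t z x <= 404 * B.
Proof.
move=> xF zF; rewrite -(odd_double_half t) -addnn; case: (odd t); last first.
  by have := kkernel_offdiag_even t./2 xF zF; have := B_ge0; rewrite add0n; lra.
have := kkernel_offdiag_even t./2.+1 xF zF.
have := kkernel_lazy R eirr deg_gt0 (1 + (t./2 + t./2)) x zF.
rewrite !add1n addSn addnS.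
move/(ler_wpM2l (sqr_ge0 (d x z))); rewrite mulrCA; lra.
Qed.

End OffDiagonal.

Section Comparison.
Variables (R : realType) (V : choiceType) (e : rel V).
Hypothesis efin : forall x, finite_set (nbhd e x).
Hypothesis deg_gt0 : forall x, (0 < deg e x)%N.
Variables (F H : {fset V}) (x : V) (M : R).
Hypotheses (HF : (H `<=` F)%fset) (M0 : 0 <= M).

Lemma kkernel_sumS G T y :
  \sum_(t < T.+1) kkernel R e G t y x =
  (y == x)%:R + \sum_(z <- G) lazyP R e y z * \sum_(t < T) kkernel R e G t z x.
Proof.
rewrite big_ord_recl /=; congr (_ + _).
by under [RHS]eq_bigr do rewrite mulr_sumr; rewrite exchange_big.
Qed.

(** Maximum principle: the difference of the two Green functions satisfies the
same recursion on H with the values of the larger one outside H as boundary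
data. *)
Lemma killing_comparison T :
  (forall z T', z \in F -> z \notin H -> (T' <= T)%N ->
     \sum_(t < T') kkernel R e F t z x <= M) ->
  forall y, \sum_(t < T) kkernel R e F t y x <=
            \sum_(t < T) kkernel R e H t y x + M.
Proof.
elim: T => [_ y|T ih hM y]; first by rewrite !big_ord0 add0r.
rewrite !kkernel_sumS -addrA lerD2l (big_fsetID _ (mem H) F) /=.
have EH (f : V -> R) : \sum_(z <- [fset z in F | z \in H]%fset) f z = \sum_(z <- H) f z.
  by apply: eq_fbigl => z; rewrite !inE /= andb_idl // => zH; apply: (fsubsetP HF).
rewrite EH.
have MP : \sum_(z <- F) lazyP R e y z * M <= M.
  by rewrite -mulr_suml -[leRHS]mul1r ler_wpM2r ?sum_lazyP_le1.
apply: le_trans (_ : _ <= \sum_(z <- H) lazyP R e y z *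
   \sum_(t < T) kkernel R e H t z x + \sum_(z <- F) lazyP R e y z * M) _; last first.
  by rewrite lerD2l.
rewrite (big_fsetID _ (mem H) F) /= EH addrA -big_split /= lerD //.
  apply: fsum_le => z _; rewrite -mulrDr ler_wpM2l ?lazyP_ge0 //.
  by apply: ih => w T' wF wH T'T; apply: hM => //; apply: leqW.
apply: fsum_le => z; rewrite !inE => /andP[zF zH].
by rewrite ler_wpM2l ?lazyP_ge0 // hM.
Qed.

End Comparison.

(** * Harmonic sums and the boundary layer *)

Lemma sum_ltn_le (n r : nat) : (\sum_(1 <= s < n) (s < r)%N <= r)%N.
Proof.
suff : (\sum_(1 <= s < n) (s < r)%N <= minn n r)%N.
  by move/leq_trans; apply; apply: geq_minr.
elim: n => [|[|n] ih]; [by rewrite big_geq..|rewrite big_nat_recr //=].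
have := ih; case: (ltnP n.+1 r); lia.
Qed.

Section Harmonic.
Variable R : realType.

Lemma ln_succ_le (n : nat) : (0 < n)%N -> ln (n.+1%:R : R) - ln n%:R <= n%:R^-1.
Proof.
move=> n0; have n0' : 0 < n%:R :> R by rewrite ltr0n.
rewrite -ln_div ?posrE ?ltr0n //.
have -> : (n.+1%:R : R) / n%:R = 1 + n%:R^-1.
  by rewrite -natr1 mulrDl divff ?gt_eqF // mul1r.
by apply: le_ln1Dx; rewrite (lt_le_trans (y := 0)) // invr_ge0 ltW.
Qed.

Lemma ln_succ_ge (n : nat) : (0 < n)%N -> n.+1%:R^-1 <= ln (n.+1%:R : R) - ln n%:R.
Proof.
move=> n0; have n0' : 0 < n%:R :> R by rewrite ltr0n.
have s0 : 0 < n.+1%:R :> R by rewrite ltr0n.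
rewrite -lerN2 opprB -ln_div ?posrE //.
have -> : (n%:R : R) / n.+1%:R = 1 + - n.+1%:R^-1.
  by rewrite -[in LHS](addrK 1 n%:R) natr1 mulrBl divff ?gt_eqF // mul1r.
by apply: le_ln1Dx; rewrite ltrN2 invf_lt1 // ltr1n.
Qed.

Lemma ln_le_harmonic (k n : nat) : (0 < k <= n)%N ->
  ln (n%:R : R) - ln k%:R <= \sum_(k <= s < n) s%:R^-1.
Proof.
case/andP=> k0; elim: n => [|n ih]; first by rewrite leqNgt k0.
rewrite leq_eqVlt => /orP[/eqP <-|]; first by rewrite subrr big_geq.
rewrite ltnS => kn; rewrite big_nat_recr //=.
have := ih kn; have := ln_succ_le (leq_trans k0 kn); lra.
Qed.

Lemma harmonic_le_ln (n : nat) : (0 < n)%N ->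
  \sum_(1 <= s < n) s%:R^-1 <= 1 + ln (n%:R : R).
Proof.
case: n => [|[|n]] // _; first by rewrite big_geq // ln1 addr0.
apply: (@le_trans _ _ (1 + ln (n.+1%:R : R))); last first.
  by rewrite lerD2l ler_ln ?posrE ?ltr0n // ler_nat.
elim: n => [|n ih]; first by rewrite big_nat1 ln1 invr1 addr0.
rewrite big_nat_recr //=; have := @ln_succ_ge n.+1 isT; move: ih.
move: (\sum_(_ <= _ < _) _) (ln n.+1%:R) (ln n.+2%:R) (_^-1) => s l l' i; lra.
Qed.

(** The terms of the window are at most c/r each and there are at most r of
them. *)
Lemma harmonic_window (n r c : nat) :
  \sum_(1 <= s < n) ((s < r <= c * s)%N%:R / s%:R) <= c%:R :> R.
Proof.
have := sum_ltn_le n r; case: r => [|r] cnt.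
  by rewrite big1 ?ler0n // => s _; rewrite mul0r.
apply: (@le_trans _ _ (\sum_(1 <= s < n) (s < r.+1)%N%:R * (c%:R / r.+1%:R))).
  apply: ler_sum_nat => s /andP[s0 _].
  case: (ltnP s r.+1) => sr; rewrite ?mul0r //=.
  case: leqP => rcs; rewrite ?mul1r ?mul0r; first by rewrite divr_ge0.
  rewrite ler_pdivlMr ?ltr0n // mulrC ler_pdivrMr ?ltr0n //.
  by rewrite -natrM ler_nat.
rewrite -mulr_suml -natr_sum.
apply: (@le_trans _ _ (r.+1%:R * (c%:R / r.+1%:R))).
  by rewrite ler_wpM2r ?divr_ge0 // ler_nat.
by rewrite mulrC divfK // pnatr_eq0.
Qed.

End Harmonic.

Section BoundaryLayer.
Variables (V : choiceType) (e : rel V).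
Hypotheses (esym : symmetric e) (econ : graph_connected e).
Hypothesis efin : forall x, finite_set (nbhd e x).
Variables (x0 : V) (r : nat).

Let H := nball e x0 r.

(** Positive inside the ball, and at most the distance to its complement. *)
Definition depth (x : V) : nat := r.+1 - gdist e x0 x.

Let inH x : (x \in H) = (gdist e x0 x <= r)%N. Proof. exact: in_nball. Qed.

Lemma depth_bounds x : x \in H -> (0 < depth x <= r.+1)%N.
Proof. by rewrite inH /depth; lia. Qed.

Lemma depth_le_gdist x z : z \notin H -> (depth x <= gdist e x z)%N.
Proof.
by rewrite inH /depth -ltnNge; have := gdist_triangle econ x x0 z; lia.
Qed.

Variables (R : realType) (v1 v2 : R).
Hypotheses (v1_gt0 : 0 < v1) (v2_gt0 : 0 < v2).
Hypothesis volume : forall x n,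
  v1 * n.+1%:R ^+ 2 <= #|` nball e x n|%:R <= v2 * n.+1%:R ^+ 2.

Let layer s := [fset x in H | (depth x <= s)%N]%fset.
Let window s := [fset x in H | (s < depth x <= 3 * s)%N]%fset.

(** Count the pairs formed by x in the layer and z in the window at distance at
most 3s.  For each x there are at least as many z as in a ball of radius s-1,
centred at the point of depth 2s on the geodesic from x0 to x; for each z there
are at most as many x as in a ball of radius 3s. *)
Lemma layer_le_window s : (0 < s)%N -> (2 * s <= r.+1)%N ->
  v1 * #|` layer s|%:R <= 16 * v2 * #|` window s|%:R.
Proof.
move=> s0 sr; have s0' : 0 < s%:R :> R by rewrite ltr0n.
rewrite -(ler_pM2r (exprn_gt0 2 s0')).
pose near x z : R := (gdist e x z <= 3 * s)%N%:R.
apply: (@le_trans _ _ (\sum_(x <- layer s) \sum_(z <- window s) near x z)).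
  rewrite (_ : v1 * _ * _ = \sum_(x <- layer s) v1 * s%:R ^+ 2); last first.
    by rewrite fsum_const; ring.
  apply: fsum_le => x; rewrite !inE /= inH => /andP[xr dx].
  have [|y [y1 y2]] := @geodesic_point _ e econ x0 x (r.+1 - 2 * s).
    by rewrite /depth in dx; lia.
  have sub : (nball e y s.-1 `<=` [fset z in window s | (gdist e x z <= 3 * s)%N])%fset.
    apply/fsubsetP => z; rewrite in_nball // !inE /= inH /depth => yz.
    have := gdist_triangle econ y x0 z; have := gdist_triangle econ z x0 y.
    have := gdist_triangle econ y x z; rewrite (gdist_sym esym econ x y).
    by rewrite (gdist_sym esym econ z y) /depth in dx *; lia.
  apply: (@le_trans _ _ #|` nball e y s.-1|%:R).
    by have /andP[+ _] := volume y s.-1; rewrite prednK.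
  apply: (@le_trans _ _ #|` [fset z in window s | (gdist e x z <= 3 * s)%N]%fset|%:R).
    by rewrite ler_nat fsubset_leq_card.
  rewrite -[leLHS]mulr1 -fsum_const.
  rewrite (fsum_eq (g := near x)); last first.
    by move=> z; rewrite !inE /near => /andP[_ /= ->].
  apply: fsum_subset; last by move=> z _; rewrite ler0n.
  by apply/fsubsetP => z; rewrite !inE => /andP[/andP[-> ->]].
rewrite exchange_big /=.
apply: (@le_trans _ _ (\sum_(z <- window s) 16 * v2 * s%:R ^+ 2)); last first.
  by rewrite fsum_const le_eqVlt; apply/orP; left; apply/eqP; ring.
apply: fsum_le => z _.
apply: (@le_trans _ _ #|` nball e z (3 * s)|%:R).
  rewrite -[leRHS]mulr1 -fsum_const (big_fsetID _ (mem (nball e z (3 * s)))) /=.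
  rewrite [X in _ + X]big1_fset ?addr0; last first.
    move=> x; rewrite !inE /near => /andP[_ /=].
    by rewrite in_nball // (gdist_sym esym econ z x) => /negPf->.
  apply: (@le_trans _ _ (\sum_(x <- [fset x in layer s | x \in nball e z (3 * s)]%fset) 1)).
    by apply: fsum_le => x _; rewrite /near lern1 leq_b1.
  apply: fsum_subset => //; by apply/fsubsetP => x; rewrite !inE /= => /andP[].
have /andP[_ /le_trans] := volume z (3 * s); apply.
rewrite (mulrC 16) -mulrA ler_wpM2l ?(ltW v2_gt0) //.
have -> : 16 * s%:R ^+ 2 = (4 * s)%N%:R ^+ 2 :> R by rewrite natrM; ring.
by rewrite ler_pXn2r ?nnegrE ?ler0n // ler_nat; lia.
Qed.

(** Expand the logarithm as a sum of 1/s over s >= depth and exchange sums: this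
weighs the layer of depth at most s by 1/s.  The layer is dominated by the
window (s, 3s] when 2s <= r+1, and by the whole ball for larger s.  In both
cases exchanging the sums back leaves a bounded harmonic window at each
point. *)
Lemma sum_log_depth :
  \sum_(x <- H) (ln r.+1%:R - ln (depth x)%:R) <=
    (48 * v2 / v1 + 2) * #|` H|%:R.
Proof.
pose N : R := #|` H|%:R.
have layer_card s : (#|` layer s| <= #|` H|)%N.
  by apply: fsubset_leq_card; apply/fsubsetP => x; rewrite !inE => /andP[].
pose kappa := 16 * v2 / v1.
have kappa0 : 0 <= kappa by rewrite divr_ge0 ?mulr_ge0 // ltW.
apply: (@le_trans _ _ (\sum_(1 <= s < r.+1) #|` layer s|%:R / s%:R)).
  apply: (@le_trans _ _ (\sum_(x <- H) \sum_(1 <= s < r.+1) (depth x <= s)%N%:R / s%:R)).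
    apply: fsum_le => x /depth_bounds /andP[d0 dr].
    apply: le_trans (ln_le_harmonic R (k := depth x) (n := r.+1) _) _.
      by rewrite d0.
    rewrite [leRHS](big_cat_nat (n := depth x)) //=.
    rewrite -[leLHS]add0r lerD //.
      by apply: sumr_ge0 => s _; rewrite divr_ge0.
    by apply: ler_sum_nat => s /andP[-> _]; rewrite mul1r.
  rewrite exchange_big /= ler_sum // => s _.
  rewrite -mulr_suml ler_wpM2r ?invr_ge0 // /layer.
  rewrite -[leRHS]mulr1 -fsum_const (big_fsetID _ (fun x => (depth x <= s)%N) H) /=.
  rewrite [X in _ + X]big1_fset ?addr0.
    by apply: fsum_le => x _; rewrite lern1 leq_b1.
  by move=> x; rewrite !inE => /andP[_ /= /negPf->].
apply: (@le_trans _ _ (\sum_(1 <= s < r.+1)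
   (kappa * (#|` window s|%:R / s%:R) + N * ((s < r.+1 <= 2 * s)%N%:R / s%:R)))).
  apply: ler_sum_nat => s /andP[s0 sr]; rewrite !mulrA -mulrDl.
  rewrite ler_wpM2r ?invr_ge0 // sr /=.
  have [h|h] := leqP (2 * s) r.+1.
    rewrite -[leLHS]addr0; apply: lerD; last by rewrite mulr_ge0.
    have := layer_le_window s0 h; rewrite /kappa -ler_pdivlMl // => /le_trans; apply.
    by rewrite le_eqVlt; apply/orP; left; apply/eqP; ring.
  rewrite (ltnW h) mulr1 -[leLHS]add0r; apply: lerD; first exact: mulr_ge0.
  by rewrite ler_nat.
rewrite big_split /= -!mulr_sumr.
have w2 := harmonic_window R r.+1 r.+1 2.
have w3 : \sum_(1 <= s < r.+1) #|` window s|%:R / s%:R <= 3 * N :> R.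
  apply: (@le_trans _ _ (\sum_(1 <= s < r.+1) \sum_(x <- H)
       (s < depth x <= 3 * s)%N%:R / s%:R)).
    apply: ler_sum => s _; rewrite -mulr_suml ler_wpM2r ?invr_ge0 //.
    rewrite -[leLHS]mulr1 -fsum_const.
    rewrite (fsum_eq (g := fun x => (s < depth x <= 3 * s)%N%:R)); last first.
      by move=> x; rewrite !inE => /andP[_ /= ->].
    apply: fsum_subset; last by move=> x _; rewrite ler0n.
    by apply/fsubsetP => x; rewrite !inE => /andP[].
  rewrite exchange_big /= mulrC /N -fsum_const; apply: fsum_le => x _.
  exact: harmonic_window.
apply: (@le_trans _ _ (kappa * (3 * N) + N * 2)).
  by apply: lerD; rewrite ler_wpM2l // /N ler0n.
by rewrite le_eqVlt; apply/orP; left; apply/eqP; rewrite /kappa; ring.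
Qed.

End BoundaryLayer.

(** * The trace of the inverse Dirichlet Laplacian *)

Section TraceFormula.
Variables (R : realType) (V : choiceType) (e : rel V).
Hypotheses (esym : symmetric e).
Hypothesis efin : forall x, finite_set (nbhd e x).
Hypothesis deg_gt0 : forall x, (0 < deg e x)%N.
Variables (H : {fset V}) (S : R).
Hypothesis S_gt0 : 0 < S.

Local Notation P := (lazyP R e).
Local Notation m := (wdeg R e).
Local Notation K := (kkernel R e H).
Local Notation n := #|{: H}|.

Hypothesis gap : forall f : V -> R, \sum_(y <- H) m y * f y ^+ 2 <= S * dirichlet_form e H f.

Let v (i : 'I_n) : V := val (enum_val i).
Let v_in i : v i \in H. Proof. exact: valP. Qed.
Let v_inj : injective v.
Proof. by move=> i j /val_inj /enum_val_inj. Qed.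

Let sum_v (f : V -> R) : \sum_(i < n) f (v i) = \sum_(y <- H) f y.
Proof.
rewrite big_seq_fsetE -(big_enum_val (fun x : H => f (val x))) /=.
exact: eq_bigl.
Qed.

Let ext (w : 'I_n -> R) (y : V) : R := \sum_(i < n) (v i == y)%:R * w i.

Let extE w i : ext w (v i) = w i.
Proof.
rewrite /ext (bigD1 i) //= eqxx mul1r big1 ?addr0 // => j ji.
by rewrite (inj_eq v_inj) (negPf ji) mul0r.
Qed.

Let Kt t : 'M[R]_n := \matrix_(i, j) K t (v i) (v j).
Let L := dirichlet_lap R e H.

Let Kt0 : Kt 0 = 1%:M.
Proof. by apply/matrixP => i j; rewrite !mxE /= (inj_eq v_inj). Qed.

Let KtD s t : Kt (s + t) = Kt s *m Kt t.
Proof.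
apply/matrixP => i j; rewrite !mxE kkernelD // -sum_v.
by apply: eq_bigr => k _; rewrite !mxE.
Qed.

Let LE : L = 1%:M - Kt 1.
Proof.
apply/matrixP => i j; rewrite !mxE /= (inj_eq v_inj); congr (_ - _).
rewrite -[LHS](fsum_delta (F := H) (fun z => P (v i) z) (v_in j)).
by apply: fsum_eq => z _; rewrite eq_sym mulrC.
Qed.

Let L_ext p (W : 'M[R]_(n, p)) i j :
  (L *m W) i j = ext (W ^~ j) (v i) - \sum_(z <- H) P (v i) z * ext (W ^~ j) z.
Proof.
rewrite LE mulmxBl mul1mx !mxE extE; congr (_ - _); rewrite -sum_v.
apply: eq_bigr => k _; rewrite extE !mxE; congr (_ * _).
rewrite -[RHS](fsum_delta (F := H) (fun z => P (v i) z) (v_in k)).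
by apply: fsum_eq => z _; rewrite eq_sym mulrC.
Qed.

Let L_unit : L \in unitmx.
Proof.
rewrite -unitmx_tr -row_free_unit; apply: inj_row_free => w wL.
have Lw : L *m w^T = 0 by apply: trmx_inj; rewrite trmx_mul trmxK wL trmx0.
pose f := ext (w^T ^~ 0).
have form0 : dirichlet_form e H f = 0.
  rewrite /dirichlet_form -sum_v big1 // => i _.
  by rewrite -(L_ext w^T i 0) Lw mxE mulr0.
have := gap f; rewrite form0 mulr0 => le0.
have pos y : y \in H -> 0 <= m y * f y ^+ 2.
  by rewrite mulr_ge0 ?sqr_ge0 // ltW // wdeg_gt0.
apply/rowP => i; rewrite mxE.
have -> : w 0 i = f (v i) by rewrite /f extE mxE.
apply/eqP; rewrite -sqrf_eq0 -(mulrI_eq0 _ (lregP (lt0r_neq0 (wdeg_gt0 R deg_gt0 (v i))))).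
rewrite eq_le pos // andbT; apply: le_trans le0.
rewrite (big_fsetD1 _ (v_in i)) /= lerDl; apply: fsum_ge0 => y.
by rewrite !inE => /andP[_ /pos].
Qed.

Let X := invmx L.

Let X_expand T : X = \sum_(t < T) Kt t + X *m Kt T.
Proof.
have tele : L *m \sum_(t < T) Kt t = 1%:M - Kt T.
  elim: T => [|T ih]; first by rewrite big_ord0 mulmx0 Kt0 subrr.
  rewrite big_ord_recr /= mulmxDr ih LE mulmxBl mul1mx -KtD add1n.
  by rewrite addrA subrK.
rewrite -[\sum_(t < T) Kt t](mulKmx L_unit) tele -/X mulmxBr mulmx1.
by rewrite subrK.
Qed.

(** A diagonal entry of K_k X K_k.  By reversibility it is the pairing, weighted by
the degree, of g = K_k(., v i) with the solution f of the Dirichlet problem with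
right-hand side g.  This pairing is the Dirichlet form of f; the gap makes it
nonnegative and, through the arithmetic-geometric mean inequality, at most S
times the squared norm of g. *)
Lemma dirichlet_residual k (i : 'I_n) :
  0 <= \sum_j Kt k i j * (X *m Kt k) j i <= S * K (k + k) (v i) (v i).
Proof.
set W := X *m Kt k; pose f := ext (W ^~ i); pose g y := K k y (v i).
have fg y : y \in H -> f y - \sum_(z <- H) P y z * f z = g y.
  move=> yH; have [j <-] : exists j, v j = y.
    by exists (enum_rank [` yH]%fset); rewrite /v enum_rankK.
  by rewrite -(L_ext W) /W mulmxA mulmxV // mul1mx mxE.
have mi := wdeg_gt0 R deg_gt0 (v i).
pose s := \sum_(y <- H) m y * f y * g y.
have -> : \sum_j Kt k i j * W j i = (m (v i))^-1 * s.
  rewrite /s -sum_v mulr_sumr; apply: eq_bigr => j _.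
  have := kkernel_rev R esym deg_gt0 k (v_in i) (v_in j).
  rewrite /f extE mxE -/(g (v j)) => h.
  by rewrite mulrAC -h mulrA mulrA mulVf ?gt_eqF // mul1r.
have sE : s = dirichlet_form e H f by apply: fsum_eq => y yH; rewrite fg.
have f2 := gap f; rewrite -sE in f2.
have f20 : 0 <= \sum_(y <- H) m y * f y ^+ 2.
  by apply: fsum_ge0 => y _; rewrite mulr_ge0 ?sqr_ge0 // ltW // wdeg_gt0.
have g2 : \sum_(y <- H) m y * g y ^+ 2 = m (v i) * K (k + k) (v i) (v i).
  rewrite kkernelD // mulr_sumr; apply: fsum_eq => y yH.
  by rewrite mulrA kkernel_rev // expr2 mulrA.
have s0 : 0 <= s by rewrite -(pmulr_rge0 _ S_gt0) (le_trans f20).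
have s1 : 2 * (S * s) <= \sum_(y <- H) m y * f y ^+ 2 +
                         S ^+ 2 * \sum_(y <- H) m y * g y ^+ 2.
  rewrite /s !mulr_sumr -big_split /=; apply: fsum_le => y _.
  rewrite -subr_ge0 [leRHS](_ : _ = m y * (f y - S * g y) ^+ 2); last by ring.
  by rewrite mulr_ge0 ?sqr_ge0 // ltW // wdeg_gt0.
rewrite mulr_ge0 ?invr_ge0 ?(ltW mi) //= ler_pdivrMl //.
rewrite g2 in s1; rewrite -(ler_pM2l S_gt0); nra.
Qed.

(** The remainder X K_2k of the geometric series has the same trace as K_k X K_k,
by cyclicity, and dirichlet_residual bounds the diagonal of the latter. *)
Lemma Z1_truncation k :
  0 <= Z1 R e H - \sum_(t < k + k) \sum_(x <- H) K t x x
    <= S * \sum_(x <- H) K (k + k) x x.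
Proof.
have -> : Z1 R e H - \sum_(t < k + k) \sum_(x <- H) K t x x =
    \sum_i \sum_j Kt k i j * (X *m Kt k) j i.
  rewrite /Z1 -/L -/X {1}(X_expand (k + k)) linearD /= linear_sum /=.
  rewrite (eq_bigr (fun t : 'I_(k + k) => \sum_(x <- H) K t x x)); last first.
    by move=> t _; rewrite -sum_v; apply: eq_bigr => i _; rewrite mxE.
  rewrite addrC addKr KtD mulmxA mxtrace_mulC.
  by apply: eq_bigr => i _; rewrite mxE.
rewrite sumr_ge0 /=; last by move=> i _; have /andP[] := dirichlet_residual k i.
rewrite -sum_v mulr_sumr; apply: ler_sum => i _.
by have /andP[] := dirichlet_residual k i.
Qed.

End TraceFormula.

(** * Spectral gap and on-diagonal sums *)

Section SpectralGap.
Variables (R : realType) (V : choiceType) (e : rel V).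
Hypotheses (esym : symmetric e) (econ : graph_connected e).
Hypothesis efin : forall x, finite_set (nbhd e x).
Hypothesis deg_gt0 : forall x, (0 < deg e x)%N.

Local Notation P := (lazyP R e).
Local Notation a := (wadj R e).
Local Notation m := (wdeg R e).

(** The edges leaving H carry the difference between the degree and the degree
inside H, so the energy in U counts at most what the Dirichlet form counts.  The
factor 2 is that of the lazy walk. *)
Lemma energy_le_dirichlet_form (H U : {fset V}) (f : V -> R) :
  (H `<=` U)%fset -> (forall y, y \notin H -> f y = 0) ->
  energy e U f <= 2 * dirichlet_form e H f.
Proof.
move=> HU f0.
have toH (g : V -> R) : (forall y, y \notin H -> g y = 0) ->
    \sum_(y <- U) g y = \sum_(y <- H) g y.
  by move=> g0; rewrite (big_fset_incl _ HU) // => y _ /g0.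
have -> : 2 * dirichlet_form e H f = \sum_(y <- H) m y * f y ^+ 2 -
    \sum_(y <- H) \sum_(z <- H) a y z * f y * f z.
  rewrite /dirichlet_form mulr_sumr -sumrB; apply: fsum_eq => y yH.
  rewrite sum_lazyP //.
  have -> : \sum_(z <- H) a y z * f y * f z = f y * \sum_(z <- H) a y z * f z.
    by rewrite mulr_sumr; apply: eq_bigr => z _; ring.
  move: (\sum_(z <- H) _) => s.
  have my := lt0r_neq0 (wdeg_gt0 R deg_gt0 y).
  by field.
have -> : energy e U f = \sum_(y <- U) (\sum_(z <- U) a y z) * f y ^+ 2 -
    \sum_(y <- U) \sum_(z <- U) a y z * f y * f z.
  rewrite /energy.
  under eq_bigr do rewrite big_mkcond /=.
  have -> : \sum_(y <- U) \sum_(z <- U) (if e y z then (f y - f z) ^+ 2 else 0) =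
     \sum_(y <- U) \sum_(z <- U) a y z * f y ^+ 2 +
     \sum_(y <- U) \sum_(z <- U) a y z * f z ^+ 2 -
     2 * \sum_(y <- U) \sum_(z <- U) a y z * f y * f z.
    rewrite mulr_sumr -big_split -sumrB; apply: eq_bigr => y _ /=.
    rewrite mulr_sumr -big_split -sumrB; apply: eq_bigr => z _ /=.
    by rewrite /wadj; case: (e y z); rewrite ?mul1r ?mul0r; ring.
  rewrite [X in _ + X - _]exchange_big /=.
  have -> : \sum_(z <- U) \sum_(y <- U) a y z * f z ^+ 2 =
            \sum_(y <- U) \sum_(z <- U) a y z * f y ^+ 2.
    by apply: eq_bigr => y _; apply: eq_bigr => z _; rewrite wadjC.
  under [in RHS]eq_bigr do rewrite mulr_suml.
  by field.
rewrite (toH (fun y => (\sum_(z <- U) a y z) * f y ^+ 2)); last first.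
  by move=> y /f0 ->; rewrite expr0n mulr0.
rewrite (toH (fun y => \sum_(z <- U) a y z * f y * f z)); last first.
  by move=> y /f0 ->; rewrite big1 // => z _; rewrite mulr0 mul0r.
rewrite lerB //; last first.
  rewrite le_eqVlt; apply/orP; left; apply/eqP; apply: eq_bigr => y _.
  by rewrite (toH (fun z => a y z * f y * f z)) // => z /f0 ->; rewrite mulr0.
by apply: fsum_le => y _; rewrite ler_wpM2r ?sqr_ge0 // sum_adj_le.
Qed.

Variables (Delta : nat) (c1 c2 CP : R).
Hypothesis deg_le : forall x, (deg e x <= Delta)%N.
Hypothesis vg : VG2 e c1 c2.
Hypothesis pi : poincare e CP.

Lemma gballF_nat (x : V) n : gballF e x (n%:R : R) = nball e x n.
Proof. by rewrite gballF_nball // natrK. Qed.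

Lemma volume_nat (x : V) n : (0 < n)%N ->
  c1 * n%:R ^+ 2 <= #|` nball e x n|%:R <= c2 * n%:R ^+ 2.
Proof.
by move=> n0; have [_ _ /(_ x n%:R)] := vg; rewrite ler1n /vol gballF_nat; apply.
Qed.

(** Chosen so that a ball of radius dilation * (r+1) has at least twice the volume
of one of radius r+1; bounding the squared dilation below by the dilation avoids
a square root. *)
Definition dilation : nat := (Num.truncn (2 * c2 / c1)).+1.

Definition gap_constant : R := 4 * CP * dilation%:R ^+ 2 * Delta%:R.

(** Extend f by zero to a ball U of at least twice the volume.  On U outside H the
extension differs from its average A by A, and this set is at least as large as
H; so the variance over U is at least the sum over H of (f - A)^2 + A^2, which is
at least half the squared norm of f.  The Poincare inequality on U concludes. *)
Lemma spectral_gap (x0 : V) (r : nat) (f : V -> R) :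
  \sum_(y <- nball e x0 r) m y * f y ^+ 2 <=
    gap_constant * r.+1%:R ^+ 2 * dirichlet_form e (nball e x0 r) f.
Proof.
have [c1_gt0 c2_gt0 _] := vg; have [CP_gt0 piE] := pi.
set H := nball e x0 r; pose f0 y := if y \in H then f y else 0.
have f0H y : y \in H -> f0 y = f y by rewrite /f0 => ->.
have -> : dirichlet_form e H f = dirichlet_form e H f0.
  apply: fsum_eq => y yH; rewrite f0H //; congr (_ * (_ - _)).
  by apply: fsum_eq => z zH; rewrite f0H.
pose k := dilation; pose U := nball e x0 (k * r.+1).
have HU : (H `<=` U)%fset.
  by apply/fsubsetP => y; rewrite !in_nball // /k /dilation; nia.
have HU2 : (H `<=` nball e x0 (2 * (k * r.+1)))%fset.
  by apply/fsubsetP => y; rewrite !in_nball // /k /dilation; nia.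
have card2 : 2 * #|` H|%:R <= #|` U|%:R :> R.
  apply: (@le_trans _ _ (2 * (c2 * r.+1%:R ^+ 2))).
    rewrite ler_wpM2l //.
    have /andP[_] := volume_nat x0 (ltn0Sn r).
    apply: le_trans; rewrite ler_nat fsubset_leq_card //.
    by apply/fsubsetP => y; rewrite !in_nball //; apply: leqW.
  have /andP[+ _] := @volume_nat x0 (k * r.+1)%N isT; apply: le_trans.
  rewrite natrM exprMn [leLHS]mulrA [leRHS]mulrA ler_wpM2r ?sqr_ge0 //.
  have k2 : 2 * c2 <= c1 * k%:R.
    by rewrite -ler_pdivrMl // mulrC ltW // /k /dilation truncnS_gt.
  apply: le_trans k2 _; rewrite expr2 mulrA ler_peMr ?ler1n //.
  by rewrite mulr_ge0 // ltW.
have := piE x0 (k * r.+1)%:R f0 (ler0n _ _).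
rewrite -natrM !gballF_nat -/U; set A := average U f0 => hP.
have lower : \sum_(y <- H) f y ^+ 2 <= 2 * \sum_(y <- U) (f0 y - A) ^+ 2.
  rewrite [X in 2 * X](big_fsetID _ (mem H)) /=.
  have -> : \sum_(y <- [fset y in U | y \in H]%fset) (f0 y - A) ^+ 2 =
            \sum_(y <- H) (f y - A) ^+ 2.
    rewrite -(fsum_eq (F := H) (f := fun y => (f0 y - A) ^+ 2)); last first.
      by move=> y yH; rewrite f0H.
    by apply: eq_fbigl => y; rewrite !inE /= andb_idl // => yH; apply: (fsubsetP HU).
  have -> : \sum_(y <- [fset y in U | y \notin H]%fset) (f0 y - A) ^+ 2 =
      #|` [fset y in U | y \notin H]%fset|%:R * A ^+ 2.
    rewrite -fsum_const; apply: fsum_eq => y; rewrite !inE => /andP[_ /negPf yH].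
    by rewrite /f0 yH sub0r sqrrN.
  have cardD : #|` H|%:R <= #|` [fset y in U | y \notin H]%fset|%:R :> R.
    have E : [fset y in U | y \notin H]%fset = (U `\` H)%fset.
      by apply/fsetP => y; rewrite !inE andbC.
    rewrite E; have := cardfsD U H; rewrite (fsetIidPr HU).
    have := fsubset_leq_card HU; move: card2; rewrite -natrM !ler_nat; lia.
  apply: (@le_trans _ _ (2 * (\sum_(y <- H) (f y - A) ^+ 2 + #|` H|%:R * A ^+ 2))).
    rewrite -fsum_const -big_split mulr_sumr; apply: fsum_le => y _ /=.
    by have := sqr_ge0 (f y - 2 * A); nra.
  by rewrite ler_wpM2l // lerD2l ler_wpM2r ?sqr_ge0.
have f0out y : y \notin H -> f0 y = 0 by rewrite /f0 => /negPf ->.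
have en := energy_le_dirichlet_form HU2 f0out.
have mD : \sum_(y <- H) m y * f y ^+ 2 <= Delta%:R * \sum_(y <- H) f y ^+ 2.
  by rewrite mulr_sumr; apply: fsum_le => y _; rewrite ler_wpM2r ?sqr_ge0 // ler_nat.
apply: le_trans mD _.
rewrite /gap_constant [leRHS](_ : _ = Delta%:R *
   (2 * (CP * (k * r.+1)%:R ^+ 2 * (2 * dirichlet_form e H f0)))); last first.
  by rewrite natrM -/k; ring.
rewrite ler_wpM2l // (le_trans lower) // ler_wpM2l // (le_trans hP) //.
by rewrite ler_wpM2l // mulr_ge0 ?sqr_ge0 // ltW.
Qed.

(** The case n = 0, outside the range of VG2, is the reason for the minimum
with 1. *)
Lemma nball_volume (x : V) n :
  Num.min 1 (c1 / 4) * n.+1%:R ^+ 2 <= #|` nball e x n|%:R <= c2 * n.+1%:R ^+ 2.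
Proof.
have [c1_gt0 c2_gt0 _] := vg; apply/andP; split; last first.
  have /andP[_] := volume_nat x (ltn0Sn n).
  apply: le_trans; rewrite ler_nat fsubset_leq_card //.
  by apply/fsubsetP => y; rewrite !in_nball //; apply: leqW.
case: n => [|n].
  rewrite expr1n mulr1 ge_min; apply/orP; left.
  rewrite ler1n cardfs_gt0; apply/fset0Pn; exists x.
  by rewrite in_nball // gdist_xx.
have /andP[+ _] := volume_nat x (ltn0Sn n).
apply: le_trans; apply: (@le_trans _ _ (c1 / 4 * n.+2%:R ^+ 2)).
  by rewrite ler_wpM2r ?sqr_ge0 // ge_min lexx orbT.
rewrite -mulrA ler_pM2l // ler_pdivrMl //.
have -> : 4 * n.+1%:R ^+ 2 = (2 * n.+1)%N%:R ^+ 2 :> R by rewrite natrM; ring.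
by rewrite ler_pXn2r ?nnegrE ?ler0n // ler_nat; lia.
Qed.

End SpectralGap.

Section OnDiagonal.
Variable R : realType.

(** Each term is dominated by a telescoping difference of delta^-1 t^-delta, since
(1 - 1/t)^-delta >= exp (delta / t) >= 1 + delta / t. *)
Lemma sum_powR_le (delta : R) (n : nat) : 0 < delta ->
  \sum_(1 <= t < n) t%:R `^ (- 1 - delta) <= 1 + delta^-1.
Proof.
move=> d0.
suff h k : \sum_(1 <= t < k.+2) t%:R `^ (- 1 - delta) <=
    1 + delta^-1 - delta^-1 * k.+1%:R `^ (- delta).
  case: n => [|[|k]]; [by rewrite big_geq // addr_ge0 // invr_ge0 ltW..|].
  apply: le_trans (h k) _; rewrite gerBl mulr_ge0 ?powR_ge0 // invr_ge0 ltW //.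
elim: k => [|k ih]; first by rewrite big_nat1 !powR1 mulr1 addrK.
rewrite big_nat_recr //=.
suff step : (k.+2%:R : R) `^ (- 1 - delta) <=
    delta^-1 * k.+1%:R `^ (- delta) - delta^-1 * k.+2%:R `^ (- delta).
  by move: ih step; lra.
rewrite -mulrBr ler_pdivlMl //.
have k1 : 0 < k.+1%:R :> R by rewrite ltr0n.
have k2 : 0 < k.+2%:R :> R by rewrite ltr0n.
have -> : (k.+2%:R : R) `^ (- 1 - delta) = k.+2%:R^-1 * k.+2%:R `^ (- delta).
  rewrite powRD; first by rewrite powR_inv1 // ltW.
  by rewrite (gt_eqF k2) implybT.
have -> : (k.+1%:R : R) `^ (- delta) = k.+2%:R `^ (- delta) *
    expR (delta * (ln k.+2%:R - ln k.+1%:R)).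
  by rewrite /powR !gt_eqF // -expRD; congr expR; ring.
have p0 : 0 < (k.+2%:R : R) `^ (- delta) by rewrite powR_gt0.
have h1 := expR_ge1Dx (delta * (ln k.+2%:R - ln (k.+1%:R : R))).
have h2 : delta * k.+2%:R^-1 <= delta * (ln k.+2%:R - ln (k.+1%:R : R)).
  by rewrite ler_pM2l // ln_succ_ge.
rewrite mulrA mulrC -[X in _ - X]mulr1 -mulrBr ler_pM2l //.
by apply: le_trans h2 _; rewrite lerBrDl.
Qed.

Variables (V : choiceType) (e : rel V).
Hypothesis efin : forall x, finite_set (nbhd e x).
Hypothesis deg_gt0 : forall x, (0 < deg e x)%N.
Variables (GG delta CQH : R) (t0 : nat).
Hypothesis qh : QH e GG delta t0 CQH.

Local Notation p t x := (heat_kernel R e t x x).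

Definition ondiag_constant : R := 1 + GG + `|CQH| + t0%:R.

(** Only the O(1/t) part of the homogenisation hypothesis is kept; the times below
t0 are covered by p_t <= 1. *)
Lemma heat_kernel_ondiag x t : p (t + t) x <= ondiag_constant / t.+1%:R.
Proof.
have [GG0 d0 qhE] := qh.
have T0 : 0 < t.+1%:R :> R by rewrite ltr0n.
have C0 : 0 <= GG + `|CQH| by rewrite addr_ge0 // ltW.
case: t T0 => [|t] T0.
  rewrite divr1 /ondiag_constant /= eqxx.
  by rewrite -!addrA lerDl addrA addr_ge0.
set s := (t.+1 + t.+1)%N; have s0 : 0 < s%:R :> R by rewrite ltr0n.
have [ts|st] := leqP t0 s; last first.
  apply: le_trans (heat_kernel_le1 R efin deg_gt0 s x x) _.
  rewrite ler_pdivlMr // mul1r /ondiag_constant.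
  have : t.+2%:R <= t0%:R :> R by rewrite ler_nat; move: st; rewrite /s; lia.
  lra.
have := qhE x s isT ts; rewrite ler_norml => /andP[_].
have pw : s%:R `^ (- 1 - delta) <= s%:R^-1 :> R.
  rewrite -(powR_inv1 (ltW s0)) ler_powR ?ler1n //; lra.
have b1 : CQH * s%:R `^ (- 1 - delta) <= `|CQH| * s%:R^-1.
  by rewrite (@le_trans _ _ (`|CQH| * s%:R `^ (- 1 - delta))) ?ler_wpM2l //
    ler_wpM2r ?powR_ge0 // ler_norm.
move=> b2; apply: (@le_trans _ _ ((GG + `|CQH|) / s%:R)).
  by rewrite mulrDl; lra.
apply: (@le_trans _ _ ((GG + `|CQH|) / t.+2%:R)).
  by rewrite ler_wpM2l // lef_pV2 ?posrE // ler_nat /s; lia.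
rewrite ler_wpM2r ?invr_ge0 ?ler0n // /ondiag_constant; have := ler0n R t0; lra.
Qed.

Definition log_constant : R :=
  1 + GG + (1 + GG) * t0%:R + `|CQH| * (1 + delta^-1).

(** The error terms of the homogenisation hypothesis are summable in t, which is
where delta > 0 enters. *)
Lemma sum_heat_kernel_ondiag x T : (0 < T)%N ->
  `|\sum_(t < T) p t x - GG * ln T%:R| <= log_constant.
Proof.
move=> T0; have [GG0 d0 qhE] := qh.
have harm : ln (T%:R : R) <= \sum_(1 <= s < T) s%:R^-1 <= 1 + ln (T%:R : R).
  have := @ln_le_harmonic R 1 T; rewrite T0 ln1 subr0 => -> //=.
  exact: harmonic_le_ln.
rewrite -(big_mkord xpredT (fun t => p t x)) big_ltn //= eqxx.
have err : `|\sum_(1 <= t < T) p t x - GG * \sum_(1 <= t < T) t%:R^-1| <=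
    (1 + GG) * t0%:R + `|CQH| * (1 + delta^-1).
  rewrite mulr_sumr -sumrB; apply: le_trans (ler_norm_sum _ _ _) _.
  apply: (@le_trans _ _ (\sum_(1 <= t < T) ((1 + GG) * (t < t0)%N%:R +
      `|CQH| * t%:R `^ (- 1 - delta)))).
    apply: ler_sum_nat => t /andP[t_gt0 _].
    have tR : 0 < t%:R :> R by rewrite ltr0n.
    have [ht|ht] := ltnP t t0.
      apply: (@le_trans _ _ (1 + GG)); last first.
        by rewrite mulr1 lerDl mulr_ge0 ?powR_ge0.
      apply: le_trans (ler_normB _ _) _; rewrite lerD //.
        by rewrite ger0_norm ?heat_kernel_ge0 // heat_kernel_le1.
      rewrite ger0_norm ?(divr_ge0 (ltW GG0) (ltW tR)) // -[leRHS]mulr1 ler_pM2l //.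
      by rewrite invf_le1 // ler1n.
    rewrite mulr0 add0r; apply: le_trans (qhE x t t_gt0 ht) _.
    by rewrite ler_wpM2r ?powR_ge0 // ler_norm.
  rewrite big_split /= -!mulr_sumr; apply: lerD; last first.
    by rewrite ler_wpM2l // sum_powR_le.
  rewrite ler_wpM2l ?(addr_ge0 ler01 (ltW GG0)) // -natr_sum ler_nat.
  exact: sum_ltn_le.
have : `|GG * (\sum_(1 <= t < T) t%:R^-1 - ln T%:R)| <= GG.
  rewrite ger0_norm; last first.
    by apply: mulr_ge0; [exact: ltW | rewrite subr_ge0; case/andP: harm].
  apply: ler_piMr; first exact: ltW.
  by rewrite lerBlDr; case/andP: harm.
move: err; rewrite !ler_norml /log_constant => /andP[e1 e2] /andP[e3 e4].
have -> : true%:R = 1 :> R by [].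
apply/andP; split; lra.
Qed.

End OnDiagonal.

(** * Asymptotics of the trace *)

Section FinitePropagation.
Variables (R : realType) (V : choiceType) (e : rel V).
Hypotheses (esym : symmetric e) (econ : graph_connected e).
Hypothesis efin : forall x, finite_set (nbhd e x).

(** The walk moves by at most one edge per step. *)
Lemma heat_kernel_eq0 t z x : (t < gdist e x z)%N -> heat_kernel R e t z x = 0.
Proof.
elim: t z => [|t ih] z tz.
  rewrite /= eq_sym; have [xz|//] := eqVneq x z.
  by rewrite xz gdist_xx in tz.
rewrite (heat_kernelS R efin (F := (z |` nbhdF e z)%fset) t x (fsubset_refl _)).
apply: big1_fset => w; rewrite in_fset1U in_nbhdF // => wz _; rewrite ih ?mulr0 //.
case/predU1P: wz => [->|zw]; first exact: ltnW.
by have := @gdist_adj _ e econ x w z; rewrite esym => /(_ zw); lia.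
Qed.

Lemma kkernel_eq_heat (F : {fset V}) x T t y : (nball e x T `<=` F)%fset ->
  (t <= T.+1)%N -> kkernel R e F t y x = heat_kernel R e t y x.
Proof.
move=> TF; elim: t y => [//|t ih] y tT.
rewrite (heat_kernelS R efin (F := ((y |` nbhdF e y) `|` F)%fset)) ?fsubsetUl //=.
rewrite -(big_fset_incl _ (fsubsetUr (y |` nbhdF e y)%fset F)).
  by apply: eq_bigr => z _; rewrite ih // ltnW.
move=> z _ zF; rewrite heat_kernel_eq0 ?mulr0 // ltnNge.
apply: contra zF => zt; apply: (fsubsetP TF).
by rewrite in_nball // (leq_trans zt).
Qed.

End FinitePropagation.

Section BallTrace.
Variables (R : realType) (Delta : nat) (c1 c2 CP GG delta : R) (t0 : nat).
Variable CQH : R.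

Definition volume_constant : R := Num.min 1 (c1 / 4).

Definition offdiag_constant : R :=
  404 * (Delta%:R * ondiag_constant GG CQH t0).

Definition upper_constant : R :=
  GG * ln 2 + log_constant GG delta CQH t0 +
    gap_constant Delta c1 c2 CP * ondiag_constant GG CQH t0.

Definition lower_constant : R :=
  2 * GG * (48 * c2 / volume_constant + 2) +
    log_constant GG delta CQH t0 + offdiag_constant.

Definition trace_constant : R :=
  `|upper_constant| + `|lower_constant| +
    GG * (`|ln volume_constant| + `|ln c2|).

Variables (V : choiceType) (e : rel V).
Hypothesis G : graph_hyp e Delta c1 c2 CP GG delta t0 CQH.

Let esym : symmetric e. Proof. by case: G => -[[]]. Qed.
Let eirr : irreflexive e. Proof. by case: G => -[[]]. Qed.
Let econ : graph_connected e. Proof. by case: G => -[]. Qed.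
Let efin x : finite_set (nbhd e x). Proof. by case: G => _ [/(_ x)[]]. Qed.
Let deg_le x : (deg e x <= Delta)%N. Proof. by case: G => _ [/(_ x)[]]. Qed.
Let vg : VG2 e c1 c2. Proof. by case: G => _ []. Qed.
Let pi : poincare e CP. Proof. by case: G => _ []. Qed.
Let qh : QH e GG delta t0 CQH. Proof. by case: G => _ []. Qed.

Let deg_gt0 x : (0 < deg e x)%N.
Proof.
have [y xy] : exists y, y != x.
  apply: contrapT => h; case: G => -[_ + _] _; apply.
  apply: (sub_finite_set (B := [set x])) => // y _ /=.
  by apply: contrapT => yx; apply: h; exists y; apply/eqP.
have [n [[|z p] /= [+ lp _]]] := econ x y; first by rewrite -lp eqxx in xy.
case/andP=> xz _; rewrite cardfs_gt0; apply/fset0Pn; exists z.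
by rewrite in_fset_set // inE.
Qed.

Let c1_gt0 : 0 < c1. Proof. by case: vg. Qed.
Let c2_gt0 : 0 < c2. Proof. by case: vg. Qed.
Let CP_gt0 : 0 < CP. Proof. by case: pi. Qed.
Let GG_gt0 : 0 < GG. Proof. by case: qh. Qed.

Let v1_gt0 : 0 < volume_constant.
Proof. by rewrite lt_min ltr01 divr_gt0. Qed.

Let ondiag_ge0 : 0 <= ondiag_constant GG CQH t0.
Proof. by rewrite !addr_ge0 // ltW. Qed.

Variables (x0 : V) (r : nat).
Let H := nball e x0 r.
Let N : R := #|` H|%:R.
Local Notation K := (kkernel R e H).

Let N_ge1 : 1 <= N.
Proof.
rewrite ler1n cardfs_gt0; apply/fset0Pn; exists x0.
by rewrite in_nball // gdist_xx.
Qed.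

Let S_gt0 : 0 < gap_constant Delta c1 c2 CP * r.+1%:R ^+ 2.
Proof.
have D0 : (0 < Delta)%N by apply: leq_trans (deg_le x0).
by rewrite !mulr_gt0 ?exprn_gt0 ?ltr0n.
Qed.

Let trunc := Z1_truncation esym deg_gt0 S_gt0
  (spectral_gap esym econ efin deg_gt0 deg_le vg pi x0 r) (r.+1 ^ 2)%N.

Let s0 : 0 < r.+1%:R :> R. Proof. by rewrite ltr0n. Qed.

Lemma Z1_nball_le : Z1 R e H <= N * (2 * GG * ln r.+1%:R + upper_constant).
Proof.
have /andP[_] := trunc; rewrite lerBlDl -/H => /le_trans; apply.
set k := (r.+1 ^ 2)%N.
rewrite exchange_big mulr_sumr -big_split /= /N -fsum_const.
apply: fsum_le => x xH.
have kR : k%:R = r.+1%:R ^+ 2 :> R by rewrite natrX.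
have k0 : (0 < k)%N by rewrite expn_gt0.
have head : \sum_(t < k + k) K t x x <=
    GG * (ln 2 + 2 * ln r.+1%:R) + log_constant GG delta CQH t0.
  apply: (@le_trans _ _ (\sum_(t < k + k) heat_kernel R e t x x)).
    by apply: ler_sum => t _; apply: kkernel_le_heat.
  have kk : (0 < k + k)%N by rewrite addn_gt0 k0.
  have := sum_heat_kernel_ondiag efin deg_gt0 qh x kk.
  rewrite ler_norml => /andP[_]; rewrite lerBlDl => /le_trans; apply.
  rewrite lerD2r addnn -mul2n natrM kR lnM ?posrE ?exprn_gt0 // lnXn //.
  by rewrite -[ln _ *+ 2]mulr_natl.
have tail : gap_constant Delta c1 c2 CP * r.+1%:R ^+ 2 * K (k + k) x x <=
    gap_constant Delta c1 c2 CP * ondiag_constant GG CQH t0.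
  have gap0 : 0 <= gap_constant Delta c1 c2 CP.
    by have := S_gt0; rewrite pmulr_lgt0 ?exprn_gt0 //; apply: ltW.
  rewrite -mulrA ler_wpM2l // -kR.
  apply: (@le_trans _ _ (k%:R * (ondiag_constant GG CQH t0 / k.+1%:R))).
    rewrite ler_wpM2l //; apply: le_trans (heat_kernel_ondiag efin deg_gt0 qh x k).
    exact: kkernel_le_heat.
  rewrite mulrA ler_pdivrMr ?ltr0n // mulrC ler_wpM2l // ler_nat //.
apply: le_trans (lerD head tail) _; rewrite le_eqVlt; apply/orP; left; apply/eqP.
by rewrite /upper_constant; ring.
Qed.

(** At x, stop the Green function at the square of the depth of x and compare
with the free walk, realised as the walk killed outside a set F that it cannot
leave before that time. *)
Lemma Z1_nball_ge : N * (2 * GG * ln r.+1%:R - lower_constant) <= Z1 R e H.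
Proof.
have /andP[+ _] := trunc; rewrite subr_ge0 -/H; apply: le_trans.
set k := (r.+1 ^ 2)%N.
have diag x : x \in H -> 2 * GG * ln (depth e x0 r x)%:R -
    log_constant GG delta CQH t0 - offdiag_constant <= \sum_(t < k + k) K t x x.
  move=> xH; have /andP[d0 dr] := depth_bounds econ efin xH.
  set rho := depth e x0 r x in d0 dr *; pose T := (rho ^ 2)%N.
  have T0 : (0 < T)%N by rewrite expn_gt0 d0.
  have M0 : 0 <= offdiag_constant.
    by rewrite /offdiag_constant mulr_ge0 ?ler0n // mulr_ge0 ?ler0n.
  pose F := (H `|` nball e x T)%fset.
  have xF : x \in F by rewrite inE xH.
  have far z T' : z \in F -> z \notin H -> (T' <= T)%N ->
      \sum_(t < T') kkernel R e F t z x <= offdiag_constant.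
    move=> zF zH T'T.
    have rz : (rho <= gdist e x z)%N by apply: depth_le_gdist zH.
    have rho0 : 0 < rho%:R :> R by rewrite ltr0n.
    apply: (@le_trans _ _ (\sum_(t < T') offdiag_constant / T%:R)).
      apply: ler_sum => t _; rewrite ler_pdivlMr ?ltr0n // mulrC.
      apply: le_trans (kkernel_offdiag esym eirr econ efin deg_gt0 deg_le
        ondiag_ge0 (heat_kernel_ondiag efin deg_gt0 qh) t xF zF).
      rewrite ler_wpM2r ?kkernel_ge0 // natrX ler_pXn2r ?nnegrE ?ler0n //.
      by rewrite ler_nat.
    rewrite sumr_const card_ord -[leLHS]mulr_natl mulrCA ler_piMr //.
    by rewrite ler_pdivrMr ?ltr0n // mul1r ler_nat.
  have HF : (H `<=` F)%fset by apply: fsubsetUl.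
  have := killing_comparison efin deg_gt0 HF M0 far x.
  have -> : \sum_(t < T) kkernel R e F t x x = \sum_(t < T) heat_kernel R e t x x.
    apply: eq_bigr => t _; apply: (kkernel_eq_heat R esym econ efin (T := T)).
      exact: fsubsetUr.
    by rewrite ltnW // ltnW // ltnS.
  have := sum_heat_kernel_ondiag efin deg_gt0 qh x T0.
  rewrite ler_norml natrX lnXn ?ltr0n // -[ln _ *+ 2]mulr_natl => /andP[+ _].
  have : \sum_(t < T) K t x x <= \sum_(t < k + k) K t x x.
    rewrite -!(big_mkord xpredT (fun t => K t x x)).
    have Tk : (T <= k + k)%N by rewrite (leq_trans _ (leq_addr _ _)) // leq_exp2r.
    rewrite [leRHS](big_cat_nat (n := T)) //= lerDl.
    by apply: sumr_ge0 => t _; apply: kkernel_ge0.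
  lra.
rewrite exchange_big /=.
apply: le_trans (fsum_le diag).
have := sum_log_depth esym econ efin x0 r v1_gt0 c2_gt0
  (nball_volume econ efin vg).
rewrite -/H -/N => layer.
apply: (@le_trans _ _ (\sum_(x <- H) (2 * GG * ln r.+1%:R -
   log_constant GG delta CQH t0 - offdiag_constant) -
   2 * GG * \sum_(x <- H) (ln r.+1%:R - ln (depth e x0 r x)%:R))).
  rewrite fsum_const -/N /lower_constant.
  have := ler_wpM2l (mulr_ge0 (ler0n _ 2) (ltW GG_gt0)) layer.
  lra.
rewrite mulr_sumr -sumrB; apply: fsum_le => x _; lra.
Qed.

(** Combine the two bounds with ln N = 2 ln (r+1) + O(1), which is VG2. *)
Lemma Z1_nball_asymptotics :
  `|Z1 R e H - GG * N * ln N| <= trace_constant * N.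
Proof.
have N0 : 0 < N by apply: lt_le_trans N_ge1.
have /andP[vl vu] := nball_volume econ efin vg x0 r.
rewrite -/H -/N -/volume_constant in vl vu.
have sq0 : 0 < r.+1%:R ^+ 2 :> R by rewrite exprn_gt0.
have lnN : `|ln N - 2 * ln r.+1%:R| <= `|ln volume_constant| + `|ln c2|.
  have ln2 : 2 * ln r.+1%:R = ln (r.+1%:R ^+ 2) :> R.
    by rewrite lnXn // -[ln _ *+ 2]mulr_natl.
  have l1 : ln volume_constant + 2 * ln r.+1%:R <= ln N.
    by rewrite ln2 -lnM ?posrE // ler_ln ?posrE ?mulr_gt0.
  have l2 : ln N <= ln c2 + 2 * ln r.+1%:R.
    by rewrite ln2 -lnM ?posrE // ler_ln ?posrE ?mulr_gt0.
  have := ler_norm (- ln volume_constant); have := ler_norm (ln c2).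
  have := normr_ge0 (ln volume_constant); have := normr_ge0 (ln c2).
  rewrite normrN ler_norml => n1 n2 n3 n4; apply/andP; split; lra.
have := Z1_nball_le; have := Z1_nball_ge.
have u := ler_norm upper_constant; have l := ler_norm lower_constant.
have u0 := normr_ge0 upper_constant; have l0 := normr_ge0 lower_constant.
rewrite /trace_constant; move: lnN u l u0 l0.
rewrite ler_norml.
set A := _ + `|ln c2|; set U := `|_|; set L := `|_|; set b := 2 * _.
move: (ln N) upper_constant lower_constant => lN uc lc /andP[a1 a2] u l u0 l0 z1 z2.
rewrite -(ler_pM2l GG_gt0) in a1; rewrite -(ler_pM2l GG_gt0) in a2.
rewrite ler_norml; apply/andP; split.
  have : N * (GG * (lN - b)) <= N * (GG * A) by rewrite ler_pM2l.
  have : N * lc <= N * L by rewrite ler_pM2l.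
  have : 0 <= N * U by rewrite mulr_ge0 // ltW.
  move: z1; rewrite /b; lra.
have : N * (GG * - A) <= N * (GG * (lN - b)) by rewrite ler_pM2l.
have : N * uc <= N * U by rewrite ler_pM2l.
have : 0 <= N * L by rewrite mulr_ge0 // ltW.
move: z2; rewrite /b; lra.
Qed.

End BallTrace.

(** The constant is the larger of the one for the absolute error and its quotient
by GG, for the relative error. *)
Lemma graph_trace_asymptotics (R : realType) (Delta : nat)
    (c1 c2 CP GG delta : R) (t0 : nat) (CQH : R) :
  exists C : R, forall (V : choiceType) (e : rel V),
    graph_hyp e Delta c1 c2 CP GG delta t0 CQH ->
    forall (x0 : V) (rad : nat -> R),
      ball_exhaustion e x0 rad -> trace_asymptotics e x0 rad GG C.
Proof.
set C := trace_constant Delta c1 c2 CP GG delta t0 CQH.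
exists (Num.max C (C / GG)) => V e G x0 rad [rad0 _ _ _] n.
have [[[esym _] _ econ] [bd _ _ [GG0 _ _]]] := G.
have efin x : finite_set (nbhd e x) by have [] := bd x.
rewrite /vol gballF_nball //=; set r := Num.truncn (rad n).
have main := Z1_nball_asymptotics G x0 r.
move: main; rewrite -/C; set Z := Z1 _ _ _; set N : R := #|` _|%:R => main.
have N0 : 0 <= N by [].
split; first by apply: le_trans main _; rewrite ler_wpM2r // le_max lexx.
move=> N1; have lnN : 0 < ln N by rewrite ln_gt0.
have Ngt0 : 0 < N by apply: lt_trans N1.
have D0 : 0 < GG * N * ln N by rewrite !mulr_gt0.
rewrite -[X in _ - X](divff (lt0r_neq0 D0)) -mulrBl normrM normfV.
rewrite (gtr0_norm D0) ler_pdivrMr // (le_trans main) //.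
apply: (@le_trans _ _ (C / GG / ln N * (GG * N * ln N))).
  rewrite le_eqVlt; apply/orP; left; apply/eqP; field.
  by rewrite !lt0r_neq0.
by rewrite ler_pM2r // ler_pM2r ?invr_gt0 // le_max lexx orbT.
Qed.

Theorem theorem1p5 (R : realType) :
  (forall (Delta : nat) (c1 c2 CP GG delta : R) (t0 : nat) (CQH eta : R),
     0 < eta < 2^-1 ->
     exists C : R,
       forall (V : choiceType) (e : rel V),
         graph_hyp e Delta c1 c2 CP GG delta t0 CQH ->
         forall (x0 : V) (rad : nat -> R),
           ball_exhaustion e x0 rad ->
           trace_asymptotics e x0 rad GG C)
  /\
  (forall (GG : R)
      (Delta : nat) (c1 c2 CP delta : R) (t0 : nat) (CQH : R)
      (Delta' : nat) (c1' c2' CP' delta' : R) (t0' : nat) (CQH' : R)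
      (A B eta : R),
     0 < eta < 2^-1 ->
     exists C : R,
       forall (V V' : choiceType) (e : rel V) (e' : rel V'),
         graph_hyp e Delta c1 c2 CP GG delta t0 CQH ->
         graph_hyp e' Delta' c1' c2' CP' GG delta' t0' CQH' ->
         quasi_isometric e e' A B ->
         forall (x0' : V') (rad' : nat -> R),
           ball_exhaustion e' x0' rad' ->
           trace_asymptotics e' x0' rad' GG C).
Proof.
split=> [Delta c1 c2 CP GG delta t0 CQH eta _|].
  exact: graph_trace_asymptotics.
move=> GG D b1 b2 Q d s0 K Delta c1 c2 CP delta t0 CQH A B eta _.
have [C hC] := graph_trace_asymptotics Delta c1 c2 CP GG delta t0 CQH.
by exists C => V V' e e' _ G' _; apply: hC.
Qed.
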